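(* Let $E=X\times Y\times Z$ and consider the system $\dot x=Ax+F(u)$, $\dot y=By+G(u)$, $\dot z=Cz+H(u)$. Assume the exponential trichotomy condition, the Lipschitz condition on $F,G,H$, the gap condition, the relation of constants and the choice-of-$\sigma$ condition (all written out in the context). Then there exists a unique Lipschitz map $\Phi:Y\to X\times Z$ such that $\operatorname{graph}(\Phi)=\{y+\Phi(y): y\in Y\}$ is the center manifold of the system, i.e. $\operatorname{graph}(\Phi)=\mathcal{M}_c$, where $\mathcal{M}_c=\{u_0\in E: u(\cdot,u_0)\in\mathcal{F}_\sigma\}$.
   Context: $X,Y,Z$ are Banach spaces, $E=X\times Y\times Z$; elements of $E$ are written $u=x+y+z$ with $x\in X$, $y\in Y$, $z\in Z$, and $\|u\|=\max\{\|x\|,\|y\|,\|z\|\}$. $A\in\mathcal{L}(X,X)$, $B\in\mathcal{L}(Y,Y)$, $C\in\mathcal{L}(Z,Z)$ are bounded linear operators, and $F\in\mathcal{C}(E,X)$, $G\in\mathcal{C}(E,Y)$, $H\in\mathcal{C}(E,Z)$. Exponential trichotomy condition: there are real constants $\alpha_x<\alpha_y\le\beta_y<\beta_z$ and $K_x,K_y,K_z$ such that for all $t\ge 0$: $\|e^{tA}\|\le K_xe^{\alpha_xt}$, $\|e^{-tC}\|\le K_ze^{-\beta_zt}$, $\|e^{-tB}\|\le K_ye^{-\beta_yt}$, $\|e^{tB}\|\le K_ye^{\alpha_yt}$. Lipschitz condition: there are $\delta_x,\delta_y,\delta_z>0$ such that for all $u_1,u_2\in E$: $\|F(u_1)-F(u_2)\|\le\delta_x\|u_1-u_2\|$,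 $\|G(u_1)-G(u_2)\|\le\delta_y\|u_1-u_2\|$, $\|H(u_1)-H(u_2)\|\le\delta_z\|u_1-u_2\|$. Gap condition: $\beta_y-\alpha_x>K_x\delta_x+K_y\delta_y$ and $\beta_z-\alpha_y>K_y\delta_y+K_z\delta_z$. Real numbers $\sigma_n,\sigma_p$ are fixed. Relation of constants: $\alpha_x<\sigma_n<\alpha_y\le\beta_y<\sigma_p<\beta_z$. Choice-of-$\sigma$ condition: $\alpha_x+K_x\delta_x<\sigma_n<\beta_y-K_y\delta_y$ and $\alpha_y+K_y\delta_y<\sigma_p<\beta_z-K_z\delta_z$. Put $\sigma(t)=\sigma_p$ for $t\ge0$ and $\sigma(t)=\sigma_n$ for $t\le0$ (the value at $t=0$ is immaterial, since only $\sigma(t)t$ is used). $\mathcal{F}_\sigma=\{\phi\in\mathcal{C}(\mathbb{R},E): \|\phi\|_\sigma:=\sup_{t\in\mathbb{R}}e^{-\sigma(t)t}\|\phi(t)\|<\infty\}$. $u(t,u_0)$, $t\in\mathbb{R}$, denotes the unique solution of the system with $u(0,u_0)=u_0$.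
   Formalization: The formal theorem additionally assumes that either F(0)=G(0)=H(0)=0 or σ_n ≤ 0 ≤ σ_p; otherwise M_c is empty and the claim fails (e.g. x'=x+1, y'=2y, z'=3z with σ_n=3/2, σ_p=5/2). *)

(* Defs.v *)
(* Standard library reals and Coquelicot. *)
From Stdlib Require Export Reals Factorial.
From Coquelicot Require Export Coquelicot.

Set Implicit Arguments.
Unset Strict Implicit.

Open Scope R_scope.

Notation Banach := (CompleteNormedModule R_AbsRing).

(* Extended-real-valued, so that a bound on [opnorm T] also asserts that [T]
   is bounded. *)
Definition opnorm (V : Banach) (T : V -> V) : Rbar :=
  Lub_Rbar (fun r => exists x : V, norm x <= 1 /\ r = norm (T x)).

(* e^{tA} x = sum_n (t^n / n!) A^n x.  For bounded [A] the exponential series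
   converges in operator norm, so its sum is computed pointwise. *)
Definition expop (V : Banach) (t : R) (A : V -> V) (x : V) : V :=
  iota (is_series (fun n : nat => scal (t ^ n / INR (fact n)) (Nat.iter n A x))).

Section System.

Variables X Y Z : Banach.

(* Coquelicot's own norm on products is Euclidean.  The max norm is needed
   here: the Lipschitz constants, hence the gap condition, refer to it.  Both
   norms induce the product topology used by [continuous]. *)
Definition maxnorm (u : X * Y * Z) : R :=
  let '(x, y, z) := u in Rmax (norm x) (Rmax (norm y) (norm z)).

Definition lipschitz_on_E (V : Banach) (f : X * Y * Z -> V) (d : R) : Prop :=
  forall u1 u2 : X * Y * Z, norm (minus (f u1) (f u2)) <= d * maxnorm (minus u1 u2).

Definition exp_trichotomy (A : X -> X) (B : Y -> Y) (C : Z -> Z)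
    (ax ay bY bz Kx Ky Kz : R) : Prop :=
  ax < ay /\ ay <= bY /\ bY < bz /\
  forall t : R, 0 <= t ->
    Rbar_le (opnorm (expop t A)) (Kx * exp (ax * t)) /\
    Rbar_le (opnorm (expop (- t) C)) (Kz * exp (- bz * t)) /\
    Rbar_le (opnorm (expop (- t) B)) (Ky * exp (- bY * t)) /\
    Rbar_le (opnorm (expop t B)) (Ky * exp (ay * t)).

Definition sigma (sn sp t : R) : R := if Rle_dec 0 t then sp else sn.

Definition sigma_norm (sn sp : R) (phi : R -> X * Y * Z) : Rbar :=
  Lub_Rbar (fun r => exists t : R, r = exp (- (sigma sn sp t * t)) * maxnorm (phi t)).

Definition F_sigma (sn sp : R) (phi : R -> X * Y * Z) : Prop :=
  (forall t : R, continuous phi t) /\ Rbar_lt (sigma_norm sn sp phi) p_infty.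

Variables (A : X -> X) (B : Y -> Y) (C : Z -> Z).
Variables (F : X * Y * Z -> X) (G : X * Y * Z -> Y) (H : X * Y * Z -> Z).

Definition solution_from (u0 : X * Y * Z) (u : R -> X * Y * Z) : Prop :=
  u 0 = u0 /\
  forall t : R,
    is_derive (fun s => fst (fst (u s))) t (plus (A (fst (fst (u t)))) (F (u t))) /\
    is_derive (fun s => snd (fst (u s))) t (plus (B (snd (fst (u t)))) (G (u t))) /\
    is_derive (fun s => snd (u s)) t (plus (C (snd (u t))) (H (u t))).

(* "The unique solution u(., u0) lies in F_sigma", with the definite
   description spelled out. *)
Definition center_manifold (sn sp : R) (u0 : X * Y * Z) : Prop :=
  exists u : R -> X * Y * Z, unique (solution_from u0) u /\ F_sigma sn sp u.

(* X * Z is identified with the subspace {y = 0} of E. *)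
Definition lipschitz_map (Phi : Y -> X * Z) : Prop :=
  exists L : R, 0 <= L /\
    forall y1 y2 : Y,
      let '(dx, dz) := minus (Phi y1) (Phi y2) in
      maxnorm (dx, zero, dz) <= L * norm (minus y1 y2).

Definition graph (Phi : Y -> X * Z) (u : X * Y * Z) : Prop :=
  exists y : Y, u = (fst (Phi y), y, snd (Phi y)).

End System.

(* Main.v *)
Require Import Defs.
From Stdlib Require Import Lra Lia List FunctionalExtensionality ClassicalEpsilon.

(** The proof is the Lyapunov-Perron method.  Put w(t) = exp (sigma(t) t), so
    that F_sigma consists of the continuous paths bounded by a multiple of w.

    For fixed forcing bounded by w, each of the three linear equations has a
    simple bounded-solution theory, because sigma lies in the two spectral
    gaps.  The X-part decays forward faster than w, so its value at t is
    determined by the forcing on (-oo, t]: there is exactly one solution of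
    weighted growth ([stable_estimate], [stable_solution_exists]).  The Z-part
    is the same statement run backwards in time.  In the Y-part every solution
    has weighted growth and the initial value is free ([center_estimate]).
    Hence, for every y0 and every path v of weighted growth, there is a path u
    of weighted growth that solves the system with nonlinearity frozen along v
    and with Y-component y0 at time 0 ([driven_by], [driven_exists]).

    The choice-of-sigma condition says precisely that v |-> u is a contraction
    in the weighted supremum norm, with a factor theta < 1; the max norm on the
    product lets the three factors be taken separately ([driven_contraction]).
    So each y0 has exactly one fixed path, and a fixed path is exactly a
    solution lying in F_sigma.  The map Phi sends y0 to the X- and Z-components
    of its fixed path at time 0.  Its graph is the center manifold, its
    Lipschitz constant K_y / (1 - theta) comes from the same contraction
    estimate with two different values of y0, and it is the only map with this
    graph.

    Membership in the center manifold also asks that the solution be unique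
    among all solutions, of whatever growth; this is a separate Gronwall-type
    argument ([solution_unique]).

    All linear estimates come from one mean value inequality applied to
    r |-> exp(rA) x(t - r), whose derivative is -exp(rA) f(t - r).  The improper
    integrals of the classical formulas are thereby replaced by limits of
    solutions of initial value problems. *)

(** * Deciding linear identities in a vector space *)

(** Linear identities between vectors are decided by reflection: both sides are
    reified, and it suffices that every atom has the same real coefficient on
    both sides, which is a matter for [ring] or [field]. *)
Inductive vexp : Type :=
| VAtom (i : nat)
| VZero
| VPlus (e1 e2 : vexp)
| VOpp (e : vexp)
| VScal (r : R) (e : vexp).

Fixpoint veval {V : ModuleSpace R_Ring} (env : list V) (e : vexp) : V :=
  match e with
  | VAtom i => nth i env zero
  | VZero => zero
  | VPlus e1 e2 => plus (veval env e1) (veval env e2)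
  | VOpp e1 => opp (veval env e1)
  | VScal r e1 => scal r (veval env e1)
  end.

Fixpoint vcoef (i : nat) (e : vexp) : R :=
  match e with
  | VAtom j => if Nat.eqb j i then 1 else 0
  | VZero => 0
  | VPlus e1 e2 => vcoef i e1 + vcoef i e2
  | VOpp e1 => - vcoef i e1
  | VScal r e1 => r * vcoef i e1
  end.

(** The combination of the list of atoms with given coefficients.  Shifting the
    coefficient function, rather than carrying an offset, keeps the induction
    for atoms definitional. *)
Fixpoint vcomb {V : ModuleSpace R_Ring} (env : list V) (c : nat -> R) : V :=
  match env with
  | nil => zero
  | v :: env' => plus (scal (c O) v) (vcomb env' (fun i => c (S i)))
  end.

Lemma vcomb_zero {V : ModuleSpace R_Ring} (env : list V) :
  vcomb env (fun _ => 0) = zero.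
Proof.
  induction env as [|v env IH]; simpl; trivial.
  rewrite IH, plus_zero_r; exact (scal_zero_l v).
Qed.

Lemma vcomb_ext {V : ModuleSpace R_Ring} (env : list V) (c d : nat -> R) :
  (forall i, (i < length env)%nat -> c i = d i) -> vcomb env c = vcomb env d.
Proof.
  revert c d; induction env as [|v env IH]; intros c d Hcd; simpl; trivial.
  simpl in Hcd; rewrite (Hcd O) by lia; f_equal.
  apply IH; intros i Hi; apply Hcd; lia.
Qed.

Lemma vcomb_plus {V : ModuleSpace R_Ring} (env : list V) (c d : nat -> R) :
  vcomb env (fun i => c i + d i) = plus (vcomb env c) (vcomb env d).
Proof.
  revert c d; induction env as [|v env IH]; intros c d; simpl.
  - now rewrite plus_zero_l.
  - rewrite IH, (scal_distr_r (c O : R_Ring) (d O) v : scal (c O + d O) v = _).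
    rewrite <- !plus_assoc; f_equal; rewrite !plus_assoc; f_equal.
    apply plus_comm.
Qed.

Lemma vcomb_scal {V : ModuleSpace R_Ring} (env : list V) (r : R) (c : nat -> R) :
  vcomb env (fun i => r * c i) = scal r (vcomb env c).
Proof.
  revert c; induction env as [|v env IH]; intros c; simpl.
  - symmetry; exact (scal_zero_r (V := V) (r : R_Ring)).
  - rewrite IH, scal_distr_l, scal_assoc; reflexivity.
Qed.

Lemma vcomb_opp {V : ModuleSpace R_Ring} (env : list V) (c : nat -> R) :
  vcomb env (fun i => - c i) = opp (vcomb env c).
Proof.
  rewrite (vcomb_ext _ _ (fun i => -1 * c i)) by (intros; ring).
  rewrite vcomb_scal; exact (scal_opp_one (vcomb env c)).
Qed.

Lemma veval_vcomb {V : ModuleSpace R_Ring} (env : list V) (e : vexp) :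
  veval env e = vcomb env (fun i => vcoef i e).
Proof.
  induction e as [j| |e1 IH1 e2 IH2|e1 IH1|r e1 IH1]; simpl.
  - revert j; induction env as [|v env IH]; intros [|j]; simpl; trivial.
    + rewrite vcomb_zero, plus_zero_r; symmetry; exact (scal_one v).
    + rewrite (IH j).
      rewrite (scal_zero_l (V := V) v : scal 0 v = zero), plus_zero_l.
      reflexivity.
  - now rewrite vcomb_zero.
  - now rewrite vcomb_plus, IH1, IH2.
  - now rewrite vcomb_opp, IH1.
  - now rewrite vcomb_scal, IH1.
Qed.

Fixpoint vcoef_eq (n : nat) (e1 e2 : vexp) : Prop :=
  match n with
  | O => True
  | S m => vcoef m e1 = vcoef m e2 /\ vcoef_eq m e1 e2
  end.

Lemma veval_eq {V : ModuleSpace R_Ring} (env : list V) (e1 e2 : vexp) :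
  vcoef_eq (length env) e1 e2 -> veval env e1 = veval env e2.
Proof.
  rewrite !veval_vcomb; intros Heq; apply vcomb_ext.
  revert Heq; generalize (length env) as n; induction n as [|n IH].
  - lia.
  - intros [Hn Heq] i Hi; destruct (Nat.eq_dec i n) as [->|Hne]; trivial.
    apply IH; trivial; lia.
Qed.

Ltac vindex v env :=
  lazymatch env with
  | v :: _ => constr:(O)
  | _ :: ?env' => let n := vindex v env' in constr:(S n)
  end.

Ltac vinsert v env :=
  match env with
  | context [v :: _] => env
  | _ => constr:(v :: env)
  end.

Ltac vatoms env t :=
  lazymatch t with
  | zero => env
  | plus ?a ?b => let env1 := vatoms env a in vatoms env1 b
  | minus ?a ?b => let env1 := vatoms env a in vatoms env1 b
  | opp ?a => vatoms env a
  | scal _ ?a => vatoms env a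
  | _ => vinsert t env
  end.

Ltac vreify env t :=
  lazymatch t with
  | zero => constr:(VZero)
  | plus ?a ?b =>
      let ea := vreify env a in let eb := vreify env b in constr:(VPlus ea eb)
  | minus ?a ?b =>
      let ea := vreify env a in let eb := vreify env b in
      constr:(VPlus ea (VOpp eb))
  | opp ?a => let ea := vreify env a in constr:(VOpp ea)
  | scal ?r ?a => let ea := vreify env a in constr:(VScal r ea)
  | _ => let i := vindex t env in constr:(VAtom i)
  end.

Ltac vec_with tac :=
  lazymatch goal with
  | |- @eq ?T ?l ?r =>
      let env0 := vatoms (@nil T) l in
      let env := vatoms env0 r in
      let el := vreify env l in
      let er := vreify env r in
      refine (@veval_eq _ env el er _);
      cbv [vcoef_eq vcoef length Nat.eqb]; repeat split; tac
  end.

Ltac vec := vec_with ltac:(ring).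
Ltac vec_field := vec_with ltac:(field).

(** * Calculus in normed spaces *)

(** The form in which the remainders of the operator exponential and of its
    product rule are estimated. *)
Lemma is_derive_eps {V : Banach} (f : R -> V) (t : R) (l : V) :
  is_derive f t l <->
  forall eps, 0 < eps -> exists d, 0 < d /\ forall h, Rabs h < d ->
    norm (minus (minus (f (t + h)) (f t)) (scal h l)) <= eps * Rabs h.
Proof.
  split.
  - intros [_ Hd] eps Heps.
    destruct (Hd t (fun P HP => HP) (mkposreal eps Heps)) as [d Hball].
    exists d; split; [apply cond_pos|]; intros h Hh.
    assert (E : t + h + - t = h) by ring.
    assert (Hb : ball t d (t + h)).
    { change (Rabs (t + h + - t) < d); now rewrite E. }
    specialize (Hball (t + h) Hb); simpl in Hball.
    change (norm (minus (minus (f (t + h)) (f t)) (scal (t + h + - t) l))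
            <= eps * Rabs (t + h + - t)) in Hball.
    now rewrite E in Hball.
  - intros Hd; split; [apply is_linear_scal_l|].
    intros x Hx.
    rewrite <- (is_filter_lim_locally_unique (V := R_NormedModule) t x Hx).
    intros eps; destruct (Hd eps (cond_pos eps)) as [d [Hd0 Hh]].
    exists (mkposreal d Hd0); intros s Hs.
    specialize (Hh (minus s t) Hs).
    replace (t + minus s t) with s in Hh; [exact Hh|].
    change ((s : R) = t + (s + - t)); ring.
Qed.

Lemma continuous_eps {V : Banach} (f : R -> V) (t : R) :
  continuous f t <->
  forall eps, 0 < eps -> exists d, 0 < d /\ forall h, Rabs h < d ->
    norm (minus (f (t + h)) (f t)) < eps.
Proof.
  transitivity (forall eps : posreal, locally t (fun s => ball_norm (f t) eps (f s))).
  { exact (filterlim_locally_ball_norm (F := locally t) f (f t)). }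
  split.
  - intros Hc eps Heps; destruct (Hc (mkposreal eps Heps)) as [d Hball].
    exists d; split; [apply cond_pos|]; intros h Hh; apply Hball.
    change (Rabs (t + h + - t) < d); now replace (t + h + - t) with h by ring.
  - intros Hc eps; destruct (Hc eps (cond_pos eps)) as [d [Hd0 Hh]].
    exists (mkposreal d Hd0); intros s Hs.
    specialize (Hh (minus s t) Hs).
    replace (t + minus s t) with s in Hh; [exact Hh|].
    change ((s : R) = t + (s + - t)); ring.
Qed.

Lemma is_derive_continuous {V : Banach} (f : R -> V) (t : R) (l : V) :
  is_derive f t l -> continuous f t.
Proof.
  intros Hd; exact (ex_derive_continuous (V := V) f t (ex_intro _ l Hd)).
Qed.

Lemma is_derive_reverse {V : Banach} (f : R -> V) (t a : R) (l : V) :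
  is_derive f (a - t) l -> is_derive (fun s => f (a - s)) t (opp l).
Proof.
  intros Hd.
  replace (opp l) with (scal (-1) l) by vec.
  apply (is_derive_comp f (fun s => a - s)); trivial.
  auto_derive; trivial; ring.
Qed.

Lemma is_derive_neg {V : Banach} (f : R -> V) (t : R) (l : V) :
  is_derive f (- t) l -> is_derive (fun s => f (- s)) t (opp l).
Proof.
  intros Hd.
  replace (opp l) with (scal (-1) l) by vec.
  apply (is_derive_comp f (fun s => - s)); trivial.
  auto_derive; trivial; ring.
Qed.

Lemma continuous_neg {V : UniformSpace} (f : R -> V) :
  (forall t, continuous f t) -> forall t, continuous (fun s => f (- s)) t.
Proof.
  intros Hf t; apply (continuous_comp (fun s : R => - s) f); trivial.
  apply (continuous_opp (V := R_NormedModule) (fun s : R => s)), continuous_id.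
Qed.

(** The only place where an integral of a vector-valued function is used for an
    estimate.  All growth bounds below are obtained by choosing [g] as an
    explicit real primitive. *)
Lemma mean_value_inequality {V : Banach} (f df : R -> V) (g dg : R -> R) (a b : R) :
  a <= b ->
  (forall s, is_derive f s (df s)) -> (forall s, continuous df s) ->
  (forall s, is_derive g s (dg s)) -> (forall s, continuous dg s) ->
  (forall s, a <= s <= b -> norm (df s) <= dg s) ->
  norm (minus (f b) (f a)) <= g b - g a.
Proof.
  intros Hab Hf Hdf Hg Hdg Hle.
  apply (norm_RInt_le df dg a b); trivial.
  - apply is_RInt_derive; auto.
  - apply (is_RInt_derive (V := R_CompleteNormedModule) g dg); auto.
Qed.

Lemma le_limit (a b c : R) :
  (forall eps, 0 < eps -> a <= b + c * eps) -> a <= b.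
Proof.
  intros Heps; destruct (Rle_or_lt a b) as [|Hlt]; trivial; exfalso.
  assert (Hc : 0 < Rabs c + 1) by (pose proof (Rabs_pos c); lra).
  assert (He : 0 < (a - b) / (2 * (Rabs c + 1))).
  { apply Rdiv_lt_0_compat; lra. }
  specialize (Heps _ He).
  assert (c * ((a - b) / (2 * (Rabs c + 1)))
          <= (Rabs c + 1) * ((a - b) / (2 * (Rabs c + 1)))).
  { apply Rmult_le_compat_r; [lra|]; pose proof (Rle_abs c); lra. }
  replace ((Rabs c + 1) * ((a - b) / (2 * (Rabs c + 1)))) with ((a - b) / 2) in H
    by (field; lra).
  lra.
Qed.

Lemma geometric_small (r eps : R) :
  0 <= r < 1 -> 0 < eps -> exists n, forall m, (n <= m)%nat -> r ^ m < eps.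
Proof.
  intros Hr Heps.
  destruct (pow_lt_1_zero r) with (y := eps) as [n Hn]; trivial.
  { rewrite Rabs_pos_eq; lra. }
  exists n; intros m Hm; eapply Rle_lt_trans; [apply Rle_abs|]; auto.
Qed.

(** Passing to the limit in a family of bounds with geometrically decaying
    error; every limit in the weighted estimates has this form. *)
Lemma le_geometric_limit (a b c r : R) :
  0 <= r < 1 -> (forall n, a <= b + c * r ^ n) -> a <= b.
Proof.
  intros Hr Hn; apply (le_limit a b (Rabs c)); intros eps Heps.
  destruct (geometric_small r eps Hr Heps) as [n Hsmall].
  specialize (Hsmall n (le_n n)); specialize (Hn n).
  assert (Hrn : 0 <= r ^ n) by (apply pow_le; lra).
  pose proof (Rmult_le_compat_r (r ^ n) _ _ Hrn (Rle_abs c)).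
  pose proof (Rmult_le_compat_l (Rabs c) _ _ (Rabs_pos c) (Rlt_le _ _ Hsmall)).
  lra.
Qed.

Lemma norm_plus_le {V : Banach} (x y : V) : norm (plus x y) <= norm x + norm y.
Proof. exact (norm_triangle x y). Qed.

Lemma norm_opp_eq {V : Banach} (x : V) : norm (opp x) = norm x.
Proof. exact (norm_opp x). Qed.

Lemma norm_minus_sym {V : Banach} (x y : V) :
  norm (minus x y) = norm (minus y x).
Proof.
  rewrite <- (norm_opp_eq (minus x y)); f_equal; vec.
Qed.

Lemma norm_minus_triangle {V : Banach} (x y z : V) :
  norm (minus x z) <= norm (minus x y) + norm (minus y z).
Proof.
  replace (minus x z) with (plus (minus x y) (minus y z)) by vec.
  apply norm_plus_le.
Qed.

Lemma norm_scal_le {V : Banach} (r : R) (x : V) :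
  norm (scal r x) <= Rabs r * norm x.
Proof. exact (norm_scal r x). Qed.

(** The limit inherits the rate, because the bound at [n] is uniform in the
    later index [m]. *)
Lemma geometric_cauchy_limit {V : Banach} (a : nat -> V) (c r : R) :
  0 <= r < 1 ->
  (forall n m, (n <= m)%nat -> norm (minus (a m) (a n)) <= c * r ^ n) ->
  exists l, forall n, norm (minus l (a n)) <= c * r ^ n.
Proof.
  intros Hr Ha.
  assert (Hc : 0 <= c).
  { pose proof (Ha O O (le_n O)) as H0; simpl in H0.
    pose proof (norm_ge_0 (minus (a O) (a O))); lra. }
  assert (Hex : exists l, filterlim a eventually (locally l)).
  { apply (proj1 (filterlim_locally_cauchy (U := V) (F := eventually) a)).
    intros eps.
    destruct (geometric_small r (eps / (c + 1)) Hr) as [N HN].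
    { apply Rdiv_lt_0_compat; [apply cond_pos|lra]. }
    assert (Hsmall : forall n, (N <= n)%nat -> c * r ^ n < eps).
    { intros n Hn; specialize (HN n Hn).
      assert (Hrn : 0 <= r ^ n) by (apply pow_le; lra).
      apply Rle_lt_trans with ((c + 1) * r ^ n); [nra|].
      apply (Rmult_lt_compat_l (c + 1)) in HN; [|lra].
      replace ((c + 1) * (eps / (c + 1))) with (pos eps) in HN by (field; lra).
      exact HN. }
    exists (fun n => (N <= n)%nat); split.
    - now exists N.
    - intros n m Hn Hm.
      assert (Hb : norm (minus (a m) (a n)) < eps).
      { destruct (Nat.le_ge_cases n m) as [Hnm|Hnm].
        - eapply Rle_lt_trans; [apply Ha|]; auto.
        - rewrite norm_minus_sym; eapply Rle_lt_trans; [apply Ha|]; auto. }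
      exact (norm_compat1 (V := V) (a n) (a m) eps Hb). }
  destruct Hex as [l Hl]; exists l; intros n.
  apply (le_limit _ _ 1); intros eps Heps.
  destruct (proj1 (filterlim_locally_ball_norm a l) Hl (mkposreal eps Heps))
    as [N HN].
  specialize (HN (Nat.max N n) (Nat.le_max_l _ _)).
  specialize (Ha n (Nat.max N n) (Nat.le_max_r _ _)).
  change (norm (minus (a (Nat.max N n)) l) < eps) in HN.
  pose proof (norm_minus_triangle l (a (Nat.max N n)) (a n)).
  rewrite (norm_minus_sym l (a (Nat.max N n))) in H;
    lra.
Qed.

(** * The operator exponential *)

Lemma iter_is_linear {V : Banach} (A : V -> V) (n : nat) :
  is_linear A -> is_linear (Nat.iter n A).
Proof.
  intros HA; induction n as [|n IH]; simpl.
  - exact (is_linear_id (V := V)).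
  - exact (is_linear_comp _ A IH HA).
Qed.

Lemma norm_iter_le {V : Banach} (A : V -> V) (M : R) (x : V) (n : nat) :
  0 <= M -> (forall v, norm (A v) <= M * norm v) ->
  norm (Nat.iter n A x) <= M ^ n * norm x.
Proof.
  intros HM HA; induction n as [|n IH]; simpl; [lra|].
  eapply Rle_trans; [apply HA|].
  rewrite Rmult_assoc; now apply Rmult_le_compat_l.
Qed.

Lemma norm_series_le {V : Banach} (a : nat -> V) (b : nat -> R) (l : V) (s : R) :
  is_series a l -> is_series b s -> (forall n, norm (a n) <= b n) -> norm l <= s.
Proof.
  intros Ha Hb Hle.
  apply (filterlim_le (F := eventually) (fun n => norm (sum_n a n)) (sum_n b)
           (Finite (norm l)) (Finite s)).
  - exists O; intros n _; induction n as [|n IH].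
    + rewrite !sum_O; apply Hle.
    + rewrite !sum_Sn; eapply Rle_trans; [exact (norm_plus_le _ _)|].
      apply Rplus_le_compat; [exact IH|apply Hle].
  - exact (filterlim_comp _ _ _ (sum_n a) norm _ _ _ Ha (filterlim_norm (V := V) l)).
  - exact Hb.
Qed.

Lemma is_series_exp (r : R) : is_series (fun n => r ^ n / INR (fact n)) (exp r).
Proof.
  apply is_series_ext with (2 := is_exp_Reals r).
  intros n; rewrite pow_n_pow; reflexivity.
Qed.

Lemma is_series_uniq {V : Banach} (a : nat -> V) (l1 l2 : V) :
  is_series a l1 -> is_series a l2 -> l1 = l2.
Proof. exact (filterlim_locally_unique (V := V) (F := eventually) (sum_n a) l1 l2). Qed.

(** Used to align the series of A exp(tA) x, which starts one index later, with
    that of exp(tA) x. *)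
Lemma is_series_shift {V : Banach} (a : nat -> V) (l : V) :
  a O = zero -> is_series (fun n => a (S n)) l -> is_series a l.
Proof.
  intros Ha Hl.
  assert (E : l = plus l (opp (a O))) by (rewrite Ha; vec).
  rewrite E in Hl; exact (is_series_decr_1 (V := V) a l Hl).
Qed.

(** The exponential series is dominated by the scalar series of
    exp(M |t|) times the norm of x; this gives convergence as well as the norm
    bound on the sum. *)
Lemma expop_term_le {V : Banach} (A : V -> V) (M t : R) (x : V) (n : nat) :
  0 <= M -> (forall v, norm (A v) <= M * norm v) ->
  norm (scal (t ^ n / INR (fact n)) (Nat.iter n A x))
  <= norm x * ((M * Rabs t) ^ n / INR (fact n)).
Proof.
  intros HM HA; eapply Rle_trans; [apply norm_scal_le|].
  pose proof (INR_fact_lt_0 n) as Hf.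
  rewrite Rabs_div by lra; rewrite (Rabs_pos_eq (INR _)) by lra.
  rewrite <- RPow_abs, Rpow_mult_distr.
  replace (norm x * (M ^ n * Rabs t ^ n / INR (fact n)))
    with (Rabs t ^ n / INR (fact n) * (M ^ n * norm x)) by (field; lra).
  apply Rmult_le_compat_l.
  - apply Rdiv_le_0_compat; trivial; apply pow_le, Rabs_pos.
  - now apply norm_iter_le.
Qed.

Lemma expop_is_series {V : Banach} (A : V -> V) (t : R) (x : V) :
  is_linear A ->
  is_series (fun n => scal (t ^ n / INR (fact n)) (Nat.iter n A x)) (expop t A x).
Proof.
  intros HA; destruct (linear_norm _ HA) as [M [HM HAM]].
  assert (Hex : ex_series (fun n => scal (t ^ n / INR (fact n)) (Nat.iter n A x) : V)).
  { apply (ex_series_le (V := V) _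
      (fun n => norm x * ((M * Rabs t) ^ n / INR (fact n)))).
    - intros n; apply expop_term_le; trivial; lra.
    - exists (norm x * exp (M * Rabs t)).
      exact (is_series_scal_l (V := R_NormedModule) (norm x) _ _ (is_series_exp _)). }
  destruct Hex as [l Hl].
  unfold expop; apply (iota_correct (V := V)); exists l; split; trivial.
  intros l' Hl'; exact (is_series_uniq _ _ _ Hl Hl').
Qed.

Lemma expop_eq {V : Banach} (A : V -> V) (t : R) (x l : V) :
  is_linear A ->
  is_series (fun n => scal (t ^ n / INR (fact n)) (Nat.iter n A x)) l ->
  expop t A x = l.
Proof.
  intros HA Hl; exact (is_series_uniq _ _ _ (expop_is_series A t x HA) Hl).
Qed.

Lemma norm_expop_le {V : Banach} (A : V -> V) (M t : R) (x : V) :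
  is_linear A -> 0 <= M -> (forall v, norm (A v) <= M * norm v) ->
  norm (expop t A x) <= exp (M * Rabs t) * norm x.
Proof.
  intros HA HM HAM; rewrite Rmult_comm.
  apply (norm_series_le _ _ _ _ (expop_is_series A t x HA)
    (is_series_scal_l (V := R_NormedModule) (norm x) _ _ (is_series_exp (M * Rabs t)))).
  intros n; now apply expop_term_le.
Qed.

Lemma expop_is_linear {V : Banach} (A : V -> V) (t : R) :
  is_linear A -> is_linear (expop t A).
Proof.
  intros HA; split.
  - intros x y; apply expop_eq; trivial.
    apply (is_series_ext (V := V)) with
      (2 := is_series_plus _ _ _ _ (expop_is_series A t x HA) (expop_is_series A t y HA)).
    intros n.
    rewrite (linear_plus _ (iter_is_linear A n HA)).
    symmetry; exact (scal_distr_l (V := V) _ _ _).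
  - intros k x; apply expop_eq; trivial.
    apply (is_series_ext (V := V)) with
      (2 := is_series_scal_l k _ _ (expop_is_series A t x HA)).
    intros n; rewrite (linear_scal _ (iter_is_linear A n HA)); vec.
  - destruct (linear_norm _ HA) as [M [HM HAM]].
    exists (exp (M * Rabs t)); split; [apply exp_pos|].
    intros x; apply norm_expop_le; trivial; lra.
Qed.

(** A is continuous, so it passes through the limit of the partial sums, and it
    commutes with its own powers. *)
Lemma expop_comm {V : Banach} (A : V -> V) (t : R) (x : V) :
  is_linear A -> A (expop t A x) = expop t A (A x).
Proof.
  intros HA; symmetry; apply expop_eq; trivial.
  apply (filterlim_ext (F := eventually)) with
    (f := fun n => A (sum_n (fun n => scal (t ^ n / INR (fact n)) (Nat.iter n A x)) n)).
  - intros n; induction n as [|n IH].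
    + rewrite !sum_O; rewrite (linear_scal _ HA); reflexivity.
    + rewrite !sum_Sn, (linear_plus _ HA), IH, (linear_scal _ HA).
      now rewrite <- (Nat.iter_succ_r (S n)).
  - exact (filterlim_comp _ _ _ _ A _ _ _ (expop_is_series A t x HA)
             (linear_cont (V := V) A _ HA)).
Qed.

Lemma expop_0 {V : Banach} (A : V -> V) (x : V) : is_linear A -> expop 0 A x = x.
Proof.
  intros HA; apply expop_eq; trivial.
  apply (filterlim_ext (F := eventually)) with (f := fun _ => x).
  - intros n; induction n as [|n IH].
    + rewrite sum_O; simpl; vec_field.
    + rewrite sum_Sn, <- IH, pow_ne_zero by lia.
      generalize (Nat.iter (S n) A x) as y; intros y.
      pose proof (INR_fact_neq_0 (S n)); vec_field; trivial.
  - apply filterlim_const.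
Qed.

Lemma iter_opp {V : Banach} (A : V -> V) (x : V) (n : nat) :
  is_linear A ->
  Nat.iter n (fun v => opp (A v)) x = scal ((-1) ^ n) (Nat.iter n A x).
Proof.
  intros HA; induction n as [|n IH]; simpl.
  - vec.
  - rewrite IH, (linear_scal _ HA); vec.
Qed.

Lemma opp_is_linear {V : Banach} (A : V -> V) :
  is_linear A -> is_linear (fun v => opp (A v)).
Proof. intros HA; exact (is_linear_comp A _ HA (is_linear_opp (V := V))). Qed.

Lemma expop_opp {V : Banach} (A : V -> V) (t : R) (x : V) :
  is_linear A -> expop t (fun v => opp (A v)) x = expop (- t) A x.
Proof.
  intros HA; apply expop_eq; [now apply opp_is_linear|].
  apply (is_series_ext (V := V)) with (2 := expop_is_series A (- t) x HA).
  intros n; rewrite iter_opp by trivial.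
  replace (- t) with (-1 * t) by ring; rewrite Rpow_mult_distr.
  pose proof (INR_fact_neq_0 n); vec_field; trivial.
Qed.

(** The induction multiplies the remainder of order n by t + h, which creates
    exactly the new term n h^2 t^(n-1). *)
Lemma pow_taylor_le (t h : R) (n : nat) :
  Rabs ((t + h) ^ S (S n) - t ^ S (S n) - INR (S (S n)) * h * t ^ S n)
  <= INR (S (S n)) * INR (S n) * (h ^ 2 * (Rabs t + Rabs h) ^ n).
Proof.
  set (r := Rabs t + Rabs h).
  assert (Hr : 0 <= r) by (unfold r; pose proof (Rabs_pos t); pose proof (Rabs_pos h); lra).
  induction n as [|n IH].
  - replace ((t + h) ^ 2 - t ^ 2 - INR 2 * h * t ^ 1) with (h ^ 2) by (simpl; ring).
    pose proof (pow2_ge_0 h); rewrite Rabs_pos_eq by trivial; simpl (INR _); simpl (r ^ 0); lra.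
  - replace ((t + h) ^ S (S (S n)) - t ^ S (S (S n)) - INR (S (S (S n))) * h * t ^ S (S n))
      with ((t + h) * ((t + h) ^ S (S n) - t ^ S (S n) - INR (S (S n)) * h * t ^ S n)
            + INR (S (S n)) * h ^ 2 * t ^ S n)
      by (rewrite (S_INR (S (S n))); simpl pow; ring).
    assert (Hth : Rabs (t + h) <= r) by apply Rabs_triang.
    assert (Ht : Rabs (t ^ S n) <= r ^ S n).
    { rewrite <- RPow_abs; apply pow_incr; unfold r.
      pose proof (Rabs_pos t); pose proof (Rabs_pos h); lra. }
    pose proof (pow2_ge_0 h) as Hh2; pose proof (pos_INR (S (S n))) as Hn2.
    eapply Rle_trans; [apply Rabs_triang|]; rewrite !Rabs_mult.
    rewrite (Rabs_pos_eq (h ^ 2)), (Rabs_pos_eq (INR _)) by trivial.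
    pose proof (Rmult_le_compat _ _ _ _ (Rabs_pos _) (Rabs_pos _) Hth IH) as H1.
    assert (Hc : 0 <= INR (S (S n)) * h ^ 2) by (apply Rmult_le_pos; trivial).
    pose proof (Rmult_le_compat_l _ _ _ Hc Ht) as H2.
    assert (Hc' : 0 <= INR (S (S n)) * h ^ 2 * r ^ S n)
      by (apply Rmult_le_pos; trivial; now apply pow_le).
    rewrite (S_INR (S (S n))).
    rewrite (S_INR (S n)) in *; simpl pow in *; lra.
Qed.

(** A quadratic remainder, obtained by comparing the three exponential series
    term by term. *)
Lemma expop_taylor {V : Banach} (A : V -> V) (M t h : R) (x : V) :
  is_linear A -> 0 <= M -> (forall v, norm (A v) <= M * norm v) ->
  norm (minus (minus (expop (t + h) A x) (expop t A x)) (scal h (expop t A (A x))))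
  <= h ^ 2 * (M ^ 2 * norm x * exp (M * (Rabs t + Rabs h))).
Proof.
  intros HA HM HAM; set (r := Rabs t + Rabs h).
  assert (Hr : 0 <= r) by (unfold r; pose proof (Rabs_pos t); pose proof (Rabs_pos h); lra).
  (* [c n] is the derivative of t^n / n!; [b n] bounds the second-order
     remainder of (t + h)^n / n! times M^n times the norm of x. *)
  set (c := fun n => match n with O => 0 | S m => t ^ m / INR (fact m) end).
  set (b := fun n => match n with
                     | O | 1%nat => 0
                     | S (S m) => h ^ 2 * (M ^ 2 * norm x) * ((M * r) ^ m / INR (fact m))
                     end).
  assert (Hc : is_series (fun n => scal (c n) (Nat.iter n A x) : V) (expop t A (A x))).
  { apply is_series_shift; [simpl; vec|].
    apply (is_series_ext (V := V)) with (2 := expop_is_series A t (A x) HA).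
    intros n; now rewrite <- Nat.iter_succ_r. }
  assert (Hb : is_series b (h ^ 2 * (M ^ 2 * norm x) * exp (M * r))).
  { apply (is_series_shift (V := R_CompleteNormedModule)); trivial.
    apply (is_series_shift (V := R_CompleteNormedModule)); trivial.
    exact (is_series_scal_l (V := R_NormedModule) _ _ _ (is_series_exp _)). }
  replace (h ^ 2 * (M ^ 2 * norm x * exp (M * r)))
    with (h ^ 2 * (M ^ 2 * norm x) * exp (M * r)) by ring.
  refine (norm_series_le _ _ _ _
    (is_series_minus (V := V) _ _ _ _
      (is_series_minus (V := V) _ _ _ _
        (expop_is_series A (t + h) x HA) (expop_is_series A t x HA))
      (is_series_scal_l (V := V) h _ _ Hc)) Hb _).
  intros n.
  match goal with |- norm ?v <= _ =>
    replace v with (scal ((t + h) ^ n / INR (fact n) - t ^ n / INR (fact n) - h * c n)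
                         (Nat.iter n A x)) by vec
  end.
  eapply Rle_trans; [apply norm_scal_le|].
  pose proof (norm_iter_le A M x n HM HAM) as Hn.
  destruct n as [|[|n]].
  - simpl; rewrite Rmult_0_r, Rminus_0_r, Rminus_diag, Rabs_R0; lra.
  - simpl; replace (_ - _) with 0 by field; rewrite Rabs_R0; lra.
  - unfold b, c.
    pose proof (pow_taylor_le t h n) as HT; fold r in HT.
    pose proof (INR_fact_lt_0 n) as Hf0; pose proof (INR_fact_lt_0 (S (S n))) as Hf.
    assert (Hfact : INR (fact (S (S n))) = INR (S (S n)) * (INR (S n) * INR (fact n)))
      by (now rewrite <- !mult_INR).
    assert (Hfact1 : INR (fact (S n)) = INR (S n) * INR (fact n))
      by (now rewrite <- !mult_INR).
    assert (HS1 : 0 < INR (S n)) by (apply lt_0_INR; lia).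
    assert (HS2 : 0 < INR (S (S n))) by (apply lt_0_INR; lia).
    replace ((t + h) ^ S (S n) / INR (fact (S (S n))) - t ^ S (S n) / INR (fact (S (S n)))
             - h * (t ^ S n / INR (fact (S n))))
      with (((t + h) ^ S (S n) - t ^ S (S n) - INR (S (S n)) * h * t ^ S n)
            / INR (fact (S (S n)))) by (rewrite Hfact, Hfact1; field; lra).
    rewrite Rabs_div by lra; rewrite (Rabs_pos_eq (INR (fact _))) by lra.
    assert (HT' : Rabs ((t + h) ^ S (S n) - t ^ S (S n) - INR (S (S n)) * h * t ^ S n)
                  / INR (fact (S (S n))) <= h ^ 2 * r ^ n / INR (fact n)).
    { apply (Rmult_le_compat_r (/ INR (fact (S (S n))))) in HT;
        [|apply Rlt_le, Rinv_0_lt_compat; lra].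
      eapply Rle_trans; [exact HT|]; right; rewrite Hfact; field; lra. }
    eapply Rle_trans.
    { apply Rmult_le_compat; [|apply norm_ge_0|exact HT'|exact Hn].
      apply Rdiv_le_0_compat; [apply Rabs_pos|lra]. }
    right; rewrite Rpow_mult_distr; simpl pow; field; lra.
Qed.

Lemma exp_le_compat (a b : R) : a <= b -> exp a <= exp b.
Proof. intros [Hlt| ->]; [now apply Rlt_le, exp_increasing|lra]. Qed.

Lemma expop_derive {V : Banach} (A : V -> V) (t : R) (x : V) :
  is_linear A -> is_derive (fun s => expop s A x) t (expop t A (A x)).
Proof.
  intros HA; destruct (linear_norm _ HA) as [M [HM HAM]].
  apply is_derive_eps; intros eps Heps.
  set (c := M ^ 2 * norm x * exp (M * (Rabs t + 1))).
  assert (Hc : 0 <= c).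
  { unfold c; pose proof (norm_ge_0 x); pose proof (exp_pos (M * (Rabs t + 1))).
    pose proof (pow2_ge_0 M); apply Rmult_le_pos; [apply Rmult_le_pos|]; lra. }
  assert (Hd : 0 < eps / (c + 1)) by (apply Rdiv_lt_0_compat; lra).
  exists (Rmin 1 (eps / (c + 1))); split; [apply Rmin_glb_lt; lra|].
  intros h Hh.
  assert (Hh1 : Rabs h < 1) by (eapply Rlt_le_trans; [exact Hh|apply Rmin_l]).
  assert (Hh2 : Rabs h < eps / (c + 1)) by (eapply Rlt_le_trans; [exact Hh|apply Rmin_r]).
  eapply Rle_trans; [apply (expop_taylor A M t h x HA); trivial; lra|].
  assert (Hle : M ^ 2 * norm x * exp (M * (Rabs t + Rabs h)) <= c).
  { apply Rmult_le_compat_l.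
    - apply Rmult_le_pos; [apply pow2_ge_0|apply norm_ge_0].
    - apply exp_le_compat, Rmult_le_compat_l; lra. }
  rewrite <- (pow2_abs h); simpl.
  pose proof (Rabs_pos h) as Hh0.
  assert (Rabs h * (c + 1) <= eps).
  { apply Rlt_le in Hh2; apply (Rmult_le_compat_r (c + 1)) in Hh2; [|lra].
    replace (eps / (c + 1) * (c + 1)) with eps in Hh2 by (field; lra); exact Hh2. }
  rewrite Rmult_1_r, (Rmult_comm eps), Rmult_assoc.
  apply Rmult_le_compat_l; trivial.
  apply Rle_trans with (Rabs h * c); [apply Rmult_le_compat_l; trivial|nra].
Qed.

(** A uniform operator bound near t, which the product rule needs in order to
    move the exponential and the vector at the same time. *)
Lemma expop_locally_bounded {V : Banach} (A : V -> V) (t : R) :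
  is_linear A ->
  exists c, 0 < c /\ forall h v, Rabs h < 1 -> norm (expop (t + h) A v) <= c * norm v.
Proof.
  intros HA; destruct (linear_norm _ HA) as [M [HM HAM]].
  exists (exp (M * (Rabs t + 1))); split; [apply exp_pos|].
  intros h v Hh; eapply Rle_trans; [apply (norm_expop_le A M); trivial; lra|].
  apply Rmult_le_compat_r; [apply norm_ge_0|].
  apply exp_le_compat, Rmult_le_compat_l; [lra|].
  pose proof (Rabs_triang t h); lra.
Qed.

Lemma expop_comp_continuous {V : Banach} (A : V -> V) (psi : R -> V) (t : R) :
  is_linear A -> continuous psi t -> continuous (fun s => expop s A (psi s)) t.
Proof.
  intros HA Hpsi; apply continuous_eps; intros eps Heps.
  destruct (expop_locally_bounded A t HA) as [c [Hc Hbd]].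
  destruct (proj1 (continuous_eps _ _) Hpsi (eps / (2 * c))) as [d1 [Hd1 H1]].
  { apply Rdiv_lt_0_compat; lra. }
  pose proof (is_derive_continuous _ _ _ (expop_derive A t (psi t) HA)) as Hcont.
  destruct (proj1 (continuous_eps _ _) Hcont (eps / 2)) as [d2 [Hd2 H2]]; [lra|].
  exists (Rmin 1 (Rmin d1 d2)); split; [repeat apply Rmin_glb_lt; lra|].
  intros h Hh; apply Rmin_Rgt in Hh; destruct Hh as [Hh Hh']; apply Rmin_Rgt in Hh'.
  destruct Hh' as [Hh1 Hh2].
  specialize (H1 h Hh1); specialize (H2 h Hh2).
  pose proof (norm_minus_triangle (expop (t + h) A (psi (t + h)))
    (expop (t + h) A (psi t)) (expop t A (psi t))) as Htri.
  rewrite <- (linear_minus _ _ _ (expop_is_linear A (t + h) HA)) in Htri.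
  pose proof (Hbd h (minus (psi (t + h)) (psi t)) Hh) as Hb.
  apply (Rmult_lt_compat_l c) in H1; trivial.
  replace (c * (eps / (2 * c))) with (eps / 2) in H1 by (field; lra).
  eapply Rle_lt_trans; [exact Htri|].
  apply Rlt_le_trans with (eps / 2 + eps / 2); [|lra].
  apply Rplus_lt_compat; trivial.
  eapply Rle_lt_trans; [exact Hb|exact H1].
Qed.

(** The product rule for a moving vector under the exponential.  The remainder
    splits into the remainder of [psi], that of the exponential on the fixed
    vector psi(t), and a continuity term for the exponential on l. *)
Lemma expop_comp_derive {V : Banach} (A : V -> V) (psi : R -> V) (t : R) (l : V) :
  is_linear A -> is_derive psi t l ->
  is_derive (fun s => expop s A (psi s)) t
    (plus (expop t A (A (psi t))) (expop t A l)).
Proof.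
  intros HA Hpsi; apply is_derive_eps; intros eps Heps.
  destruct (expop_locally_bounded A t HA) as [c [Hc Hbd]].
  destruct (proj1 (is_derive_eps _ _ _) Hpsi (eps / (3 * c))) as [d1 [Hd1 H1]].
  { apply Rdiv_lt_0_compat; lra. }
  destruct (proj1 (is_derive_eps _ _ _) (expop_derive A t (psi t) HA) (eps / 3))
    as [d2 [Hd2 H2]]; [lra|].
  pose proof (is_derive_continuous _ _ _ (expop_derive A t l HA)) as Hcont.
  destruct (proj1 (continuous_eps _ _) Hcont (eps / 3)) as [d3 [Hd3 H3]]; [lra|].
  exists (Rmin 1 (Rmin d1 (Rmin d2 d3))); split; [repeat apply Rmin_glb_lt; lra|].
  intros h Hh; apply Rmin_Rgt in Hh; destruct Hh as [Hh Hh']; apply Rmin_Rgt in Hh'.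
  destruct Hh' as [Hh1 Hh']; apply Rmin_Rgt in Hh'; destruct Hh' as [Hh2 Hh3].
  specialize (H1 h Hh1); specialize (H2 h Hh2); specialize (H3 h Hh3).
  pose proof (Hbd h (minus (minus (psi (t + h)) (psi t)) (scal h l)) Hh) as Hb.
  rewrite !(linear_minus _ _ _ (expop_is_linear A (t + h) HA)) in Hb.
  rewrite (linear_scal _ (expop_is_linear A (t + h) HA)) in Hb.
  match goal with |- norm ?v <= _ =>
    replace v with
      (plus (minus (minus (expop (t + h) A (psi (t + h))) (expop (t + h) A (psi t)))
                   (scal h (expop (t + h) A l)))
        (plus (minus (minus (expop (t + h) A (psi t)) (expop t A (psi t)))
                     (scal h (expop t A (A (psi t)))))
              (scal h (minus (expop (t + h) A l) (expop t A l))))) by vec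
  end.
  eapply Rle_trans; [apply norm_plus_le|].
  replace (eps * Rabs h) with (eps / 3 * Rabs h + (eps / 3 * Rabs h + eps / 3 * Rabs h))
    by field.
  apply Rplus_le_compat.
  - eapply Rle_trans; [exact Hb|].
    replace (eps / 3 * Rabs h) with (c * (eps / (3 * c) * Rabs h)) by (field; lra).
    apply Rmult_le_compat_l; [lra|exact H1].
  - eapply Rle_trans; [apply norm_plus_le|]; apply Rplus_le_compat; [exact H2|].
    eapply Rle_trans; [apply norm_scal_le|].
    rewrite Rmult_comm; apply Rmult_le_compat_r; [apply Rabs_pos|lra].
Qed.

(** * Inhomogeneous linear equations *)

Definition lin_sol {V : Banach} (A : V -> V) (f x : R -> V) : Prop :=
  forall t, is_derive x t (plus (A (x t)) (f t)).

Lemma lin_sol_continuous {V : Banach} (A : V -> V) (f x : R -> V) :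
  lin_sol A f x -> forall t, continuous x t.
Proof. intros Hx t; exact (is_derive_continuous _ _ _ (Hx t)). Qed.

Lemma lin_sol_minus {V : Banach} (A : V -> V) (f g x y : R -> V) :
  is_linear A -> lin_sol A f x -> lin_sol A g y ->
  lin_sol A (fun t => minus (f t) (g t)) (fun t => minus (x t) (y t)).
Proof.
  intros HA Hx Hy t; rewrite (linear_minus _ _ _ HA).
  replace (plus _ _) with
    (minus (plus (A (x t)) (f t)) (plus (A (y t)) (g t))) by vec.
  exact (is_derive_minus (V := V) _ _ _ _ _ (Hx t) (Hy t)).
Qed.

Lemma lin_sol_reverse {V : Banach} (A : V -> V) (f x : R -> V) :
  lin_sol A f x ->
  lin_sol (fun v => opp (A v)) (fun t => opp (f (- t))) (fun t => x (- t)).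
Proof.
  intros Hx t; cbv beta.
  replace (plus _ _) with (opp (plus (A (x (- t))) (f (- t)))) by vec.
  exact (is_derive_neg _ _ _ (Hx (- t))).
Qed.

(** The two terms with A cancel because A commutes with its exponential.  In
    the elapsed time r, a forward estimate involves the exponential at r >= 0
    only, which is where the trichotomy gives bounds. *)
Lemma variation_of_constants_derive {V : Banach} (A : V -> V) (f x : R -> V) (t r : R) :
  is_linear A -> lin_sol A f x ->
  is_derive (fun s => expop s A (x (t - s))) r (opp (expop r A (f (t - r)))).
Proof.
  intros HA Hx.
  pose proof (expop_comp_derive A (fun s => x (t - s)) r _ HA
    (is_derive_reverse x r t _ (Hx (t - r)))) as Hd.
  replace (opp (expop r A (f (t - r)))) with
    (plus (expop r A (A (x (t - r))))
       (expop r A (opp (plus (A (x (t - r))) (f (t - r)))))); trivial.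
  rewrite (linear_opp _ _ (expop_is_linear A r HA)).
  rewrite (linear_plus _ (expop_is_linear A r HA)); vec.
Qed.

(** The variation of constants formula as an inequality: with the integral
    term controlled by a real primitive [g], no vector-valued integral has to
    be written. *)
Lemma variation_of_constants_le {V : Banach} (A : V -> V) (f x : R -> V)
    (g dg : R -> R) (t T : R) :
  is_linear A -> lin_sol A f x -> (forall s, continuous f s) -> 0 <= T ->
  (forall s, is_derive g s (dg s)) -> (forall s, continuous dg s) ->
  (forall r, 0 <= r <= T -> norm (expop r A (f (t - r))) <= dg r) ->
  norm (minus (x t) (expop T A (x (t - T)))) <= g T - g 0.
Proof.
  intros HA Hx Hf HT Hg Hdg Hle.
  rewrite norm_minus_sym.
  replace (x t) with (expop 0 A (x (t - 0))) by (rewrite Rminus_0_r; now apply expop_0).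
  apply (mean_value_inequality (fun r => expop r A (x (t - r)))
    (fun r => opp (expop r A (f (t - r)))) g dg); trivial.
  - intros s; now apply variation_of_constants_derive.
  - intros s; apply (continuous_opp (V := V)); apply expop_comp_continuous; trivial.
    apply (continuous_comp (fun r : R => t - r) f); trivial.
    apply (is_derive_continuous (V := R_CompleteNormedModule) _ _ (-1)).
    auto_derive; trivial; ring.
  - intros s Hs; rewrite norm_opp_eq; auto.
Qed.

(** For t >= 0 this is the variation of constants estimate with zero forcing,
    on the interval from -t to 0; for negative t, replace A by -A. *)
Lemma expop_inverse {V : Banach} (A : V -> V) (t : R) (v : V) :
  is_linear A -> expop t A (expop (- t) A v) = v.
Proof.
  assert (Hpos : forall (B : V -> V) T w, is_linear B -> 0 <= T ->
            expop T B (expop (- T) B w) = w).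
  { intros B T w HB HT.
    assert (Hsol : lin_sol B (fun _ => zero) (fun s => expop s B w)).
    { intros s; replace (plus _ _) with (expop s B (B w))
        by (rewrite (expop_comm B s w HB); vec).
      now apply expop_derive. }
    pose proof (variation_of_constants_le B (fun _ => zero) (fun s => expop s B w)
      (fun _ => 0) (fun _ => 0) 0 T HB Hsol) as Hle.
    rewrite Rminus_0_l, Rminus_0_r, (expop_0 B w HB) in Hle.
    symmetry; apply (plus_reg_r (opp (expop T B (expop (- T) B w)))).
    rewrite plus_opp_r; apply (norm_eq_zero (V := V)).
    apply Rle_antisym; [|apply norm_ge_0].
    apply Hle; trivial.
    - intros s; apply continuous_const.
    - intros s; exact (is_derive_const (V := R_NormedModule) 0 s).
    - intros s; apply continuous_const.
    - intros r _; cbv beta.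
      rewrite (linear_zero _ (expop_is_linear B r HB) : expop r B zero = zero).
      right; exact (norm_zero (V := V)). }
  intros HA; destruct (Rle_or_lt 0 t) as [Ht|Ht]; [now apply Hpos|].
  pose proof (Hpos (fun v => opp (A v)) (- t) v (opp_is_linear A HA)) as Hn.
  rewrite !expop_opp, !Ropp_involutive in Hn by trivial; apply Hn; lra.
Qed.

(** The classical formula x(t) = exp(tA) (x0 + integral from 0 to t of
    exp(-sA) f(s) ds), differentiated by the product rule. *)
Lemma lin_sol_exists {V : Banach} (A : V -> V) (f : R -> V) (x0 : V) :
  is_linear A -> (forall t, continuous f t) -> exists x, lin_sol A f x /\ x 0 = x0.
Proof.
  intros HA Hf.
  set (k := fun s => expop (- s) A (f s)).
  assert (Hk : forall s, continuous k s).
  { intros s.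
    apply (continuous_ext (fun s => expop s (fun v => opp (A v)) (f s))).
    - intros r; now apply expop_opp.
    - apply expop_comp_continuous; auto; now apply opp_is_linear. }
  assert (Hint : forall a b, is_RInt k a b (RInt k a b)).
  { intros a b; apply (RInt_correct (V := V)), (ex_RInt_continuous (V := V)); auto. }
  exists (fun t => expop t A (plus x0 (RInt k 0 t))); split.
  - intros t.
    assert (Hd : is_derive (fun s => plus x0 (RInt k 0 s)) t (k t)).
    { replace (k t) with (plus zero (k t)) by vec.
      apply (is_derive_plus (V := V) (fun _ => x0) (fun s => RInt k 0 s)).
      - exact (is_derive_const (V := V) x0 t).
      - apply (is_derive_RInt (V := V) k (fun s => RInt k 0 s) 0 t); auto.
        exists (mkposreal 1 Rlt_0_1); auto. }
    pose proof (expop_comp_derive A _ t _ HA Hd) as Hx.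
    rewrite (expop_inverse A t (f t) HA : expop t A (k t) = f t) in Hx.
    rewrite <- expop_comm in Hx by trivial.
    exact Hx.
  - rewrite expop_0 by trivial.
    rewrite (RInt_point (V := V)); vec.
Qed.

(** One form for all four trichotomy inequalities: those for negative times are
    inequalities for the negated generator. *)
Definition exp_bound {V : Banach} (A : V -> V) (K a : R) : Prop :=
  forall t v, 0 <= t -> norm (expop t A v) <= K * exp (a * t) * norm v.

Lemma lin_sol_plus_expop {V : Banach} (A : V -> V) (f x : R -> V) (v : V) :
  is_linear A -> lin_sol A f x -> lin_sol A f (fun t => plus (x t) (expop t A v)).
Proof.
  intros HA Hx t; rewrite (linear_plus _ HA), (expop_comm A t v HA).
  replace (plus _ (f t)) with (plus (plus (A (x t)) (f t)) (expop t A (A v))) by vec.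
  exact (is_derive_plus (V := V) _ _ _ _ _ (Hx t) (expop_derive A t v HA)).
Qed.

(** The integral of K exp(ar) M W exp(-rho r) over [0, T] is at most
    K M W / (rho - a), hence at most N W.  Stating the hypothesis as
    K M <= N (rho - a) avoids divisions, and allows K = 0. *)
Lemma lin_sol_decay {V : Banach} (A : V -> V) (f x : R -> V) (K a rho M N W t T : R) :
  is_linear A -> exp_bound A K a -> 0 <= K -> 0 <= N -> 0 <= W -> 0 <= T -> a < rho ->
  K * M <= N * (rho - a) ->
  lin_sol A f x -> (forall s, continuous f s) ->
  (forall r, 0 <= r <= T -> norm (f (t - r)) <= M * (W * exp (- rho * r))) ->
  norm (x t) <= K * exp (a * T) * norm (x (t - T)) + N * W.
Proof.
  intros HA Hexp HK HN HW HT Hrho HKM Hx Hf Hfle.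
  assert (Hvoc : norm (minus (x t) (expop T A (x (t - T))))
                 <= - (N * W) * exp (- (rho - a) * T)
                    - - (N * W) * exp (- (rho - a) * 0)).
  { apply (variation_of_constants_le A f x (fun r => - (N * W) * exp (- (rho - a) * r))
      (fun r => N * (rho - a) * W * exp (- (rho - a) * r)) t T); trivial.
    - intros s; auto_derive; trivial; ring.
    - intros s; apply (ex_derive_continuous (V := R_NormedModule)); auto_derive; trivial.
    - intros r Hr; eapply Rle_trans; [apply Hexp; lra|].
      pose proof (exp_pos (a * r)); pose proof (exp_pos (- (rho - a) * r)).
      apply Rle_trans with (K * exp (a * r) * (M * (W * exp (- rho * r)))).
      + apply Rmult_le_compat_l; [apply Rmult_le_pos; lra|auto].
      + replace (K * exp (a * r) * (M * (W * exp (- rho * r))))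
          with (K * M * (W * (exp (a * r) * exp (- rho * r)))) by ring.
        rewrite <- exp_plus.
        replace (a * r + - rho * r) with (- (rho - a) * r) by ring.
        rewrite (Rmult_assoc (N * (rho - a))).
        apply Rmult_le_compat_r; trivial; apply Rmult_le_pos; lra. }
  rewrite Rmult_0_r, exp_0 in Hvoc.
  assert (0 <= N * W * exp (- (rho - a) * T)).
  { pose proof (exp_pos (- (rho - a) * T)); apply Rmult_le_pos; [apply Rmult_le_pos|]; lra. }
  pose proof (Hexp T (x (t - T)) HT).
  replace (x t) with (plus (minus (x t) (expop T A (x (t - T)))) (expop T A (x (t - T))))
    by vec.
  eapply Rle_trans; [apply norm_plus_le|]; lra.
Qed.

(** * Estimates in the weighted norm *)

(** The reciprocal of the factor in the norm of F_sigma. *)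
Definition weight (sn sp t : R) : R := exp (sigma sn sp t * t).

Lemma weight_pos (sn sp t : R) : 0 < weight sn sp t.
Proof. apply exp_pos. Qed.

Lemma weight_0 (sn sp : R) : weight sn sp 0 = 1.
Proof. unfold weight; rewrite Rmult_0_r; apply exp_0. Qed.

(** Time reversal exchanges and negates the two rates, so the unstable part is
    the stable part of the reversed system. *)
Lemma weight_neg (sn sp t : R) : weight (- sp) (- sn) t = weight sn sp (- t).
Proof.
  unfold weight, sigma; f_equal.
  destruct (Rle_dec 0 t), (Rle_dec 0 (- t)); try ring; try lra.
  replace t with 0 by lra; ring.
Qed.

(** Going back over positive times the weight changes at rate sp, over negative
    times at rate sn, and sn <= sp.  The smaller rate bounds both, so the
    stable estimate needs no case distinction at time 0. *)
Lemma weight_past (sn sp t r : R) :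
  sn <= sp -> 0 <= r -> weight sn sp (t - r) <= weight sn sp t * exp (- sn * r).
Proof.
  intros Hs Hr; unfold weight, sigma; rewrite <- exp_plus; apply exp_le_compat.
  destruct (Rle_dec 0 (t - r)), (Rle_dec 0 t); nra.
Qed.

Lemma weight_future (sn sp t r : R) :
  0 <= r <= t -> weight sn sp (t - r) = weight sn sp t * exp (- sp * r).
Proof.
  intros Hr; unfold weight, sigma; rewrite <- exp_plus; f_equal.
  destruct (Rle_dec 0 (t - r)), (Rle_dec 0 t); lra.
Qed.

Lemma exp_mul_INR (c : R) (n : nat) : exp (c * INR n) = exp c ^ n.
Proof.
  induction n as [|n IH]; [now rewrite Rmult_0_r, exp_0|].
  rewrite S_INR, Rmult_plus_distr_l, Rmult_1_r, exp_plus, IH; simpl; ring.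
Qed.

Lemma exp_neg_lt_1 (c : R) : 0 < c -> 0 <= exp (- c) < 1.
Proof.
  intros Hc; split; [apply Rlt_le, exp_pos|].
  rewrite <- exp_0; apply exp_increasing; lra.
Qed.

Definition weighted_le {V : Banach} (sn sp : R) (x : R -> V) (N : R) : Prop :=
  forall t, norm (x t) <= N * weight sn sp t.

Lemma weighted_le_reverse {V : Banach} (sn sp : R) (x : R -> V) (N : R) :
  weighted_le sn sp x N -> weighted_le (- sp) (- sn) (fun t => x (- t)) N.
Proof. intros Hx t; rewrite weight_neg; apply Hx. Qed.

Lemma weighted_le_of_reverse {V : Banach} (sn sp : R) (x : R -> V) (N : R) :
  weighted_le (- sp) (- sn) (fun t => x (- t)) N -> weighted_le sn sp x N.
Proof.
  intros Hx t; specialize (Hx (- t)); rewrite weight_neg, Ropp_involutive in Hx.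
  exact Hx.
Qed.

Lemma weighted_le_opp {V : Banach} (sn sp : R) (x : R -> V) (N : R) :
  weighted_le sn sp x N -> weighted_le sn sp (fun t => opp (x t)) N.
Proof. intros Hx t; rewrite norm_opp_eq; apply Hx. Qed.

Lemma weighted_le_nonneg {V : Banach} (sn sp : R) (x : R -> V) (N : R) :
  weighted_le sn sp x N -> 0 <= N.
Proof.
  intros Hx; specialize (Hx 0); rewrite weight_0, Rmult_1_r in Hx.
  exact (Rle_trans _ _ _ (norm_ge_0 (x 0)) Hx).
Qed.

Lemma lin_sol_decay_past {V : Banach} (A : V -> V) (f x : R -> V) (K a sn sp M N t T : R) :
  is_linear A -> exp_bound A K a -> 0 <= K -> 0 <= N -> 0 <= T -> a < sn -> sn <= sp ->
  K * M <= N * (sn - a) ->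
  lin_sol A f x -> (forall s, continuous f s) -> weighted_le sn sp f M ->
  norm (x t) <= K * exp (a * T) * norm (x (t - T)) + N * weight sn sp t.
Proof.
  intros HA Hexp HK HN HT Ha Hs HKM Hx Hf Hfle.
  apply (lin_sol_decay A f x K a sn M N); trivial; [apply Rlt_le, weight_pos|].
  intros r Hr; eapply Rle_trans; [apply Hfle|].
  apply Rmult_le_compat_l; [now apply weighted_le_nonneg in Hfle|].
  apply weight_past; lra.
Qed.

(** Start at time t - T and let T tend to infinity: the influence of the initial
    value is at most exp((a - sn) T) times a constant and disappears, whatever
    the a priori bound [L].  With f = 0 this also gives uniqueness. *)
Lemma stable_estimate {V : Banach} (A : V -> V) (f x : R -> V) (K a sn sp M N L : R) :
  is_linear A -> exp_bound A K a -> 0 <= K -> 0 <= N -> a < sn -> sn <= sp ->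
  K * M <= N * (sn - a) ->
  lin_sol A f x -> (forall s, continuous f s) -> weighted_le sn sp f M ->
  weighted_le sn sp x L -> weighted_le sn sp x N.
Proof.
  intros HA Hexp HK HN Ha Hs HKM Hx Hf Hfle HxL t.
  apply (le_geometric_limit _ _ (K * L * weight sn sp t) (exp (- (sn - a)))).
  { apply exp_neg_lt_1; lra. }
  intros n; rewrite <- exp_mul_INR.
  eapply Rle_trans.
  { apply (lin_sol_decay_past A f x K a sn sp M N t (INR n)); trivial; apply pos_INR. }
  rewrite Rplus_comm; apply Rplus_le_compat_l.
  apply Rle_trans with
    (K * exp (a * INR n) * (L * (weight sn sp t * exp (- sn * INR n)))).
  - apply Rmult_le_compat_l; [pose proof (exp_pos (a * INR n)); apply Rmult_le_pos; lra|].
    eapply Rle_trans; [apply HxL|].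
    apply Rmult_le_compat_l; [now apply weighted_le_nonneg in HxL|].
    apply weight_past; trivial; apply pos_INR.
  - right; replace (- (sn - a) * INR n) with (a * INR n + - sn * INR n) by ring.
    rewrite exp_plus; ring.
Qed.

(** The solutions [x n] that vanish at time -n satisfy the bound on [-n, oo).
    Two of them differ by a solution of the homogeneous equation that is of
    size w(-n) at time -n, hence of size exp((a - sn) n) at time 0; so their
    values at 0 converge geometrically. *)
Lemma stable_solution_exists {V : Banach} (A : V -> V) (f : R -> V) (K a sn sp M N : R) :
  is_linear A -> exp_bound A K a -> 0 <= K -> 0 <= N -> a < sn -> sn <= sp ->
  K * M <= N * (sn - a) ->
  (forall s, continuous f s) -> weighted_le sn sp f M ->
  exists x, lin_sol A f x /\ weighted_le sn sp x N.
Proof.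
  intros HA Hexp HK HN Ha Hs HKM Hf Hfle.
  destruct (lin_sol_exists A f zero HA Hf) as [y [Hy _]].
  set (r := exp (- (sn - a))).
  assert (Hr : 0 <= r < 1) by (apply exp_neg_lt_1; lra).
  (* [v n] is the vector for which y + exp(tA) (v n) vanishes at t = -n. *)
  set (v := fun n => opp (expop (INR n) A (y (- INR n)))).
  set (x := fun n t => plus (y t) (expop t A (v n))).
  assert (Hx : forall n, lin_sol A f (x n)) by (intros n; now apply lin_sol_plus_expop).
  assert (Hx0 : forall n, x n (- INR n) = zero).
  { intros n; unfold x, v; rewrite (linear_opp _ _ (expop_is_linear A _ HA)).
    pose proof (expop_inverse A (- INR n) (y (- INR n)) HA) as E.
    rewrite Ropp_involutive in E; rewrite E; vec. }
  assert (Hxle : forall n t, - INR n <= t -> norm (x n t) <= N * weight sn sp t).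
  { intros n t Ht.
    pose proof (lin_sol_decay_past A f (x n) K a sn sp M N t (t + INR n)) as Hd.
    replace (t - (t + INR n)) with (- INR n) in Hd by ring.
    rewrite Hx0, (norm_zero : norm (zero : V) = 0), Rmult_0_r, Rplus_0_l in Hd.
    apply Hd; trivial; lra. }
  destruct (geometric_cauchy_limit v (K * N) r Hr) as [l Hl].
  { intros n m Hnm.
    assert (E : minus (v m) (v n) = expop (INR n) A (x m (- INR n))).
    { replace (x m (- INR n)) with (minus (x m (- INR n)) (x n (- INR n)))
        by (rewrite Hx0; vec).
      replace (minus (x m (- INR n)) (x n (- INR n)))
        with (expop (- INR n) A (minus (v m) (v n))).
      - symmetry; now apply expop_inverse.
      - rewrite (linear_minus _ _ _ (expop_is_linear A _ HA)); unfold x; vec. }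
    rewrite E; eapply Rle_trans; [apply Hexp, pos_INR|].
    unfold r; rewrite <- exp_mul_INR.
    replace (- (sn - a) * INR n) with (a * INR n + - sn * INR n) by ring.
    rewrite exp_plus.
    replace (K * N * (exp (a * INR n) * exp (- sn * INR n)))
      with (K * exp (a * INR n) * (N * exp (- sn * INR n))) by ring.
    apply Rmult_le_compat_l; [pose proof (exp_pos (a * INR n)); apply Rmult_le_pos; lra|].
    eapply Rle_trans; [apply Hxle|].
    - apply Ropp_le_contravar; now apply le_INR.
    - apply Rmult_le_compat_l; trivial.
      pose proof (weight_past sn sp 0 (INR n) Hs (pos_INR n)) as Hw.
      rewrite weight_0, Rminus_0_l, Rmult_1_l in Hw; exact Hw. }
  exists (fun t => plus (y t) (expop t A l)); split; [now apply lin_sol_plus_expop|].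
  intros t; destruct (expop_locally_bounded A t HA) as [c [Hc Hbd]].
  (* The bound on [x n] holds at t only once -n <= t, hence the shift by [n0]. *)
  destruct (INR_unbounded (- t)) as [n0 Hn0].
  apply (le_geometric_limit _ _ (c * (K * N * r ^ n0)) r Hr); intros n.
  replace (plus (y t) (expop t A l))
    with (plus (x (n0 + n)%nat t) (expop t A (minus l (v (n0 + n)%nat))))
    by (rewrite (linear_minus _ _ _ (expop_is_linear A _ HA)); unfold x; vec).
  eapply Rle_trans; [apply norm_plus_le|]; apply Rplus_le_compat.
  - apply Hxle; rewrite plus_INR; pose proof (pos_INR n); lra.
  - replace (c * (K * N * r ^ n0) * r ^ n) with (c * (K * N * r ^ (n0 + n)))
      by (rewrite pow_add; ring).
    eapply Rle_trans.
    + rewrite <- (Rplus_0_r t); apply Hbd; rewrite Rabs_R0; lra.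
    + apply Rmult_le_compat_l; [lra|apply Hl].
Qed.

Lemma center_estimate_future {V : Banach} (B : V -> V) (g y : R -> V)
    (K a sn sp M N : R) :
  is_linear B -> exp_bound B K a -> 0 <= K -> 0 <= N -> a < sp ->
  K * M <= N * (sp - a) ->
  lin_sol B g y -> (forall s, continuous g s) -> weighted_le sn sp g M ->
  forall t, 0 <= t -> norm (y t) <= (K * norm (y 0) + N) * weight sn sp t.
Proof.
  intros HB Hexp HK HN Ha HKM Hy Hg Hgle t Ht.
  eapply Rle_trans.
  { apply (lin_sol_decay B g y K a sp M N (weight sn sp t) t t); trivial.
    - apply Rlt_le, weight_pos.
    - intros r Hr; rewrite <- (weight_future sn sp t r Hr); apply Hgle. }
  rewrite Rminus_diag, Rmult_plus_distr_r; apply Rplus_le_compat_r.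
  rewrite Rmult_assoc, (Rmult_comm (exp _)), <- Rmult_assoc.
  apply Rmult_le_compat_l; [apply Rmult_le_pos; trivial; apply norm_ge_0|].
  unfold weight, sigma; destruct (Rle_dec 0 t); [|lra].
  apply exp_le_compat, Rmult_le_compat_r; lra.
Qed.

(** Both directions of time are the same forward estimate, applied to B on t >= 0
    and to -B, with the reversed weight, on t <= 0. *)
Lemma center_estimate {V : Banach} (B : V -> V) (g y : R -> V) (K a b sn sp M N : R) :
  is_linear B -> exp_bound B K a -> exp_bound (fun v => opp (B v)) K (- b) ->
  0 <= K -> 0 <= N -> a < sp -> sn < b ->
  K * M <= N * (sp - a) -> K * M <= N * (b - sn) ->
  lin_sol B g y -> (forall s, continuous g s) -> weighted_le sn sp g M ->
  weighted_le sn sp y (K * norm (y 0) + N).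
Proof.
  intros HB Hfut Hpast HK HN Ha Hb HKa HKb Hy Hg Hgle t.
  destruct (Rle_or_lt 0 t) as [Ht|Ht].
  { now apply (center_estimate_future B g y K a sn sp M N). }
  assert (H : norm (y (- - t)) <= (K * norm (y (- 0)) + N) * weight (- sp) (- sn) (- t)).
  { apply (center_estimate_future (fun v => opp (B v)) (fun s => opp (g (- s)))
      (fun s => y (- s)) K (- b) (- sp) (- sn) M N); trivial; try lra.
    - now apply opp_is_linear.
    - now apply lin_sol_reverse.
    - intros s; apply (continuous_opp (V := V)); now apply continuous_neg.
    - now apply weighted_le_opp, weighted_le_reverse. }
  rewrite weight_neg, Ropp_involutive, Ropp_0 in H; exact H.
Qed.

Lemma unstable_estimate {V : Banach} (C : V -> V) (h z : R -> V) (K b sn sp M N L : R) :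
  is_linear C -> exp_bound (fun v => opp (C v)) K (- b) -> 0 <= K -> 0 <= N ->
  sp < b -> sn <= sp -> K * M <= N * (b - sp) ->
  lin_sol C h z -> (forall s, continuous h s) -> weighted_le sn sp h M ->
  weighted_le sn sp z L -> weighted_le sn sp z N.
Proof.
  intros HC Hexp HK HN Hb Hs HKM Hz Hh Hhle HzL.
  apply weighted_le_of_reverse.
  apply (stable_estimate (fun v => opp (C v)) (fun s => opp (h (- s))) (fun s => z (- s))
    K (- b) (- sp) (- sn) M N L); trivial; try lra.
  - now apply opp_is_linear.
  - now apply lin_sol_reverse.
  - intros s; apply (continuous_opp (V := V)); now apply continuous_neg.
  - now apply weighted_le_opp, weighted_le_reverse.
  - now apply weighted_le_reverse.
Qed.

Lemma unstable_solution_exists {V : Banach} (C : V -> V) (h : R -> V)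
    (K b sn sp M N : R) :
  is_linear C -> exp_bound (fun v => opp (C v)) K (- b) -> 0 <= K -> 0 <= N ->
  sp < b -> sn <= sp -> K * M <= N * (b - sp) ->
  (forall s, continuous h s) -> weighted_le sn sp h M ->
  exists z, lin_sol C h z /\ weighted_le sn sp z N.
Proof.
  intros HC Hexp HK HN Hb Hs HKM Hh Hhle.
  destruct (stable_solution_exists (fun v => opp (C v)) (fun s => opp (h (- s)))
    K (- b) (- sp) (- sn) M N) as [z [Hz HzN]]; trivial; try lra.
  - now apply opp_is_linear.
  - intros s; apply (continuous_opp (V := V)); now apply continuous_neg.
  - now apply weighted_le_opp, weighted_le_reverse.
  - exists (fun t => z (- t)); split.
    + intros t; pose proof (lin_sol_reverse _ _ _ Hz t) as Hd; cbv beta in Hd.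
      rewrite Ropp_involutive in Hd.
      replace (plus (C (z (- t))) (h t))
        with (plus (opp (opp (C (z (- t))))) (opp (opp (h t)))) by vec; exact Hd.
    + intros t; rewrite <- (Ropp_involutive t) at 2; rewrite <- weight_neg; apply HzN.
Qed.

(** * Operator norms, Lipschitz maps and paths in the product *)

(** The unit-ball supremum bounds the norm at every vector after rescaling.  The
    sign of c comes from evaluating at zero, which covers the trivial space. *)
Lemma opnorm_bound {V : Banach} (T : V -> V) (c : R) :
  is_linear T -> Rbar_le (opnorm T) c -> 0 <= c /\ forall v, norm (T v) <= c * norm v.
Proof.
  intros HT Hop.
  assert (Hball : forall v, norm v <= 1 -> norm (T v) <= c).
  { intros v Hv; destruct (Lub_Rbar_correct
      (fun r => exists x : V, norm x <= 1 /\ r = norm (T x))) as [Hub _].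
    apply (Rbar_le_trans (norm (T v)) (opnorm T) c); trivial.
    apply Hub; now exists v. }
  split.
  - apply Rle_trans with (norm (T zero)); [apply norm_ge_0|].
    apply Hball; rewrite (norm_zero : norm (zero : V) = 0); lra.
  - intros v; destruct (Req_dec (norm v) 0) as [Hv|Hv].
    + rewrite Hv, (norm_eq_zero (V := V) v Hv : v = zero).
      rewrite (linear_zero _ HT : T zero = zero), (norm_zero : norm (zero : V) = 0); lra.
    + pose proof (norm_ge_0 v) as Hv0.
      replace (T v) with (scal (norm v) (T (scal (/ norm v) v)))
        by (rewrite (linear_scal _ HT); vec_field; trivial).
      eapply Rle_trans; [apply norm_scal_le|].
      rewrite Rabs_pos_eq, Rmult_comm by trivial; apply Rmult_le_compat_r; trivial.
      apply Hball; eapply Rle_trans; [apply norm_scal_le|].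
      rewrite Rabs_pos_eq; [right; field; trivial|].
      apply Rlt_le, Rinv_0_lt_compat; lra.
Qed.

Lemma lipschitz_le {X Y Z V : Banach} (f : X * Y * Z -> V) (d r : R) (u v : X * Y * Z) :
  lipschitz_on_E f d -> 0 <= d ->
  norm (minus (fst (fst u)) (fst (fst v))) <= r ->
  norm (minus (snd (fst u)) (snd (fst v))) <= r ->
  norm (minus (snd u) (snd v)) <= r ->
  norm (minus (f u) (f v)) <= d * r.
Proof.
  intros Hf Hd Hx Hy Hz; eapply Rle_trans; [apply Hf|].
  apply Rmult_le_compat_l; trivial.
  destruct u as [[x1 y1] z1], v as [[x2 y2] z2].
  repeat apply Rmax_lub; [exact Hx|exact Hy|exact Hz].
Qed.

Lemma continuous_fst_path {U V : UniformSpace} (p : R -> U * V) (t : R) :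
  continuous p t -> continuous (fun s => fst (p s)) t.
Proof.
  intros Hp; apply (continuous_comp p fst); trivial.
  destruct (p t); apply continuous_fst.
Qed.

Lemma continuous_snd_path {U V : UniformSpace} (p : R -> U * V) (t : R) :
  continuous p t -> continuous (fun s => snd (p s)) t.
Proof.
  intros Hp; apply (continuous_comp p snd); trivial.
  destruct (p t); apply continuous_snd.
Qed.

Lemma continuous_pair_path {U V : UniformSpace} (p : R -> U * V) (t : R) :
  continuous (fun s => fst (p s)) t -> continuous (fun s => snd (p s)) t ->
  continuous p t.
Proof.
  intros H1 H2; apply (continuous_ext (fun s => (fst (p s), snd (p s)))).
  - intros s; now destruct (p s).
  - apply (continuous_comp_2 (fun s => fst (p s)) (fun s => snd (p s)) pair); trivial.
    apply (continuous_ext (fun q => q)); [now intros []|apply continuous_id].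
Qed.

(** * Uniqueness for the initial value problem *)

(** The integral of L m exp(2 L r) from 0 to s is at most half of
    m exp(2 L s): measured against exp(2 L s), integration of an L-Lipschitz
    right-hand side contracts by 1/2. *)
Lemma exponential_growth_halved {V : Banach} (x dx : R -> V) (L m T : R) :
  x 0 = zero -> (forall s, is_derive x s (dx s)) -> (forall s, continuous dx s) ->
  0 <= L -> 0 <= m ->
  (forall s, 0 <= s <= T -> norm (dx s) <= L * (m * exp (2 * L * s))) ->
  forall s, 0 <= s <= T -> norm (x s) <= m / 2 * exp (2 * L * s).
Proof.
  intros Hx0 Hx Hdx HL Hm Hle s Hs.
  replace (x s) with (minus (x s) (x 0)) by (rewrite Hx0; vec).
  apply Rle_trans with (m / 2 * exp (2 * L * s) - m / 2 * exp (2 * L * 0)).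
  - apply (mean_value_inequality x dx (fun r => m / 2 * exp (2 * L * r))
      (fun r => L * (m * exp (2 * L * r))) 0 s); trivial; try lra.
    + intros r; auto_derive; trivial; field.
    + intros r; apply (ex_derive_continuous (V := R_NormedModule)); auto_derive; trivial.
    + intros r Hr; apply Hle; lra.
  - pose proof (exp_pos (2 * L * 0)).
    assert (0 <= m / 2 * exp (2 * L * 0)) by (apply Rmult_le_pos; lra); lra.
Qed.

Lemma solution_lin_sol {X Y Z : Banach} (A : X -> X) (B : Y -> Y) (C : Z -> Z)
    (F : X * Y * Z -> X) (G : X * Y * Z -> Y) (H : X * Y * Z -> Z) u0 (u : R -> X * Y * Z) :
  solution_from A B C F G H u0 u <->
  u 0 = u0 /\
  lin_sol A (fun t => F (u t)) (fun t => fst (fst (u t))) /\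
  lin_sol B (fun t => G (u t)) (fun t => snd (fst (u t))) /\
  lin_sol C (fun t => H (u t)) (fun t => snd (u t)).
Proof.
  split.
  - intros [H0 Hd]; split; trivial.
    split; [|split]; intros t; destruct (Hd t) as [Hx [Hy Hz]]; assumption.
  - intros [H0 [Hx [Hy Hz]]]; split; trivial; intros t; split; [|split];
      [exact (Hx t)|exact (Hy t)|exact (Hz t)].
Qed.

Lemma solution_continuous {X Y Z : Banach} (A : X -> X) (B : Y -> Y) (C : Z -> Z)
    (F : X * Y * Z -> X) (G : X * Y * Z -> Y) (H : X * Y * Z -> Z) u0 (u : R -> X * Y * Z) :
  solution_from A B C F G H u0 u -> forall t, continuous u t.
Proof.
  intros Hu t; apply solution_lin_sol in Hu; destruct Hu as [_ [Hx [Hy Hz]]].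
  apply continuous_pair_path; [apply continuous_pair_path|].
  - exact (lin_sol_continuous _ _ _ Hx t).
  - exact (lin_sol_continuous _ _ _ Hy t).
  - exact (lin_sol_continuous _ _ _ Hz t).
Qed.

Lemma lin_sol_halved {V : Banach} (A : V -> V) (f x : R -> V) (k d L m T : R) :
  is_linear A -> (forall v, norm (A v) <= k * norm v) -> 0 <= k -> k + d <= L -> 0 <= L ->
  (forall s, continuous f s) -> lin_sol A f x -> x 0 = zero -> 0 <= m ->
  (forall s, 0 <= s <= T -> norm (x s) <= m * exp (2 * L * s)) ->
  (forall s, 0 <= s <= T -> norm (f s) <= d * (m * exp (2 * L * s))) ->
  forall s, 0 <= s <= T -> norm (x s) <= m / 2 * exp (2 * L * s).
Proof.
  intros HA Hk Hk0 HkL HL Hf Hx Hx0 Hm Hxle Hfle.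
  apply (exponential_growth_halved x (fun s => plus (A (x s)) (f s))); trivial.
  - intros s; apply (continuous_plus (V := V)); trivial.
    apply (continuous_comp x A); [exact (lin_sol_continuous _ _ _ Hx s)|].
    exact (linear_cont (V := V) A _ HA).
  - intros s Hs; eapply Rle_trans; [apply norm_plus_le|].
    assert (He : 0 <= m * exp (2 * L * s))
      by (pose proof (exp_pos (2 * L * s)); apply Rmult_le_pos; lra).
    apply Rle_trans with ((k + d) * (m * exp (2 * L * s)));
      [|now apply Rmult_le_compat_r].
    rewrite Rmult_plus_distr_r; apply Rplus_le_compat; [|now apply Hfle].
    eapply Rle_trans; [apply Hk|]; apply Rmult_le_compat_l; auto.
Qed.

Lemma lin_sol_bounded {V : Banach} (A : V -> V) (f x : R -> V) (T : R) :
  lin_sol A f x -> exists m, 0 <= m /\ forall s, 0 <= s <= T -> norm (x s) <= m.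
Proof.
  intros Hx; destruct (bounded_continuity (V := V) x 0 T) as [m Hm].
  - intros s _; exact (lin_sol_continuous _ _ _ Hx s).
  - exists (Rmax 0 m); split; [apply Rmax_l|]; intros s Hs.
    eapply Rle_trans; [apply Rlt_le, Hm; trivial|apply Rmax_r].
Qed.

(** On [0, T] the difference of two solutions is bounded by some
    m exp(2 L s); by the preceding estimate this bound can be halved
    indefinitely.  On a bounded interval nothing has to be known about the
    growth of the competing solution. *)
Lemma solution_unique_future {X Y Z : Banach} (A : X -> X) (B : Y -> Y) (C : Z -> Z)
    (F : X * Y * Z -> X) (G : X * Y * Z -> Y) (H : X * Y * Z -> Z)
    (dx dy dz : R) u0 (u v : R -> X * Y * Z) :
  is_linear A -> is_linear B -> is_linear C ->
  (forall u, continuous F u) -> (forall u, continuous G u) -> (forall u, continuous H u) ->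
  0 <= dx -> 0 <= dy -> 0 <= dz ->
  lipschitz_on_E F dx -> lipschitz_on_E G dy -> lipschitz_on_E H dz ->
  solution_from A B C F G H u0 u -> solution_from A B C F G H u0 v ->
  forall t, 0 <= t -> u t = v t.
Proof.
  intros HA HB HC HF HG HH Hdx Hdy Hdz FL GL HL Hu Hv T HT.
  pose proof (solution_continuous _ _ _ _ _ _ _ _ Hu) as Cu.
  pose proof (solution_continuous _ _ _ _ _ _ _ _ Hv) as Cv.
  apply solution_lin_sol in Hu; destruct Hu as [Hu0 [Hux [Huy Huz]]].
  apply solution_lin_sol in Hv; destruct Hv as [Hv0 [Hvx [Hvy Hvz]]].
  pose proof (lin_sol_minus _ _ _ _ _ HA Hux Hvx) as Hx.
  pose proof (lin_sol_minus _ _ _ _ _ HB Huy Hvy) as Hy.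
  pose proof (lin_sol_minus _ _ _ _ _ HC Huz Hvz) as Hz.
  destruct (linear_norm _ HA) as [kx [Hkx HAk]].
  destruct (linear_norm _ HB) as [ky [Hky HBk]].
  destruct (linear_norm _ HC) as [kz [Hkz HCk]].
  destruct (lin_sol_bounded _ _ _ T Hx) as [mx [Hmx Hxm]].
  destruct (lin_sol_bounded _ _ _ T Hy) as [my [Hmy Hym]].
  destruct (lin_sol_bounded _ _ _ T Hz) as [mz [Hmz Hzm]].
  set (L := kx + dx + (ky + dy) + (kz + dz)); set (m := mx + my + mz).
  assert (HLp : 0 <= L) by (unfold L; lra).
  assert (Hexp1 : forall s, 0 <= s -> 1 <= exp (2 * L * s)).
  { intros s Hs; rewrite <- exp_0; apply exp_le_compat.
    repeat apply Rmult_le_pos; lra. }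
  assert (Hn : forall n s, 0 <= s <= T ->
    norm (minus (fst (fst (u s))) (fst (fst (v s)))) <= m * (1 / 2) ^ n * exp (2 * L * s) /\
    norm (minus (snd (fst (u s))) (snd (fst (v s)))) <= m * (1 / 2) ^ n * exp (2 * L * s) /\
    norm (minus (snd (u s)) (snd (v s))) <= m * (1 / 2) ^ n * exp (2 * L * s)).
  { assert (Hm : 0 <= m) by (unfold m; lra).
    induction n as [|n IH]; intros s Hs.
    - rewrite pow_O, Rmult_1_r.
      assert (m <= m * exp (2 * L * s)).
      { rewrite <- (Rmult_1_r m) at 1; apply Rmult_le_compat_l; trivial; now apply Hexp1. }
      specialize (Hxm s Hs); specialize (Hym s Hs); specialize (Hzm s Hs).
      cbv beta in Hxm, Hym, Hzm; unfold m in *; split; [|split]; lra.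
    - set (q := m * (1 / 2) ^ n) in *.
      assert (Hq : 0 <= q) by (apply Rmult_le_pos; [trivial|apply pow_le; lra]).
      replace (m * (1 / 2) ^ S n) with (q / 2) by (unfold q; simpl; field).
      split; [|split]; revert s Hs.
      + apply (lin_sol_halved A _ _ kx dx L q T HA HAk) with (5 := Hx); trivial;
          try (unfold L; lra).
        * intros s; apply (continuous_minus (V := X));
            [now apply (continuous_comp u F)|now apply (continuous_comp v F)].
        * cbv beta; rewrite Hu0, Hv0; vec.
        * intros s Hs; now destruct (IH s Hs).
        * intros s Hs; apply lipschitz_le; trivial; now destruct (IH s Hs) as [? [? ?]].
      + apply (lin_sol_halved B _ _ ky dy L q T HB HBk) with (5 := Hy); trivial;
          try (unfold L; lra).
        * intros s; apply (continuous_minus (V := Y));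
            [now apply (continuous_comp u G)|now apply (continuous_comp v G)].
        * cbv beta; rewrite Hu0, Hv0; vec.
        * intros s Hs; now destruct (IH s Hs) as [? [? ?]].
        * intros s Hs; apply lipschitz_le; trivial; now destruct (IH s Hs) as [? [? ?]].
      + apply (lin_sol_halved C _ _ kz dz L q T HC HCk) with (5 := Hz); trivial;
          try (unfold L; lra).
        * intros s; apply (continuous_minus (V := Z));
            [now apply (continuous_comp u H)|now apply (continuous_comp v H)].
        * cbv beta; rewrite Hu0, Hv0; vec.
        * intros s Hs; now destruct (IH s Hs) as [? [? ?]].
        * intros s Hs; apply lipschitz_le; trivial; now destruct (IH s Hs) as [? [? ?]]. }
  assert (Heq : forall (V : Banach) (a b : V),
    (forall n, norm (minus a b) <= m * (1 / 2) ^ n * exp (2 * L * T)) -> a = b).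
  { intros V a b Hab; apply (plus_reg_r (opp b)); rewrite plus_opp_r.
    apply (norm_eq_zero (V := V)), Rle_antisym; [|apply norm_ge_0].
    apply (le_geometric_limit _ _ (m * exp (2 * L * T)) (1 / 2)); [lra|].
    intros n; rewrite Rplus_0_l; eapply Rle_trans; [apply (Hab n)|right; ring]. }
  assert (HTT : 0 <= T <= T) by lra.
  rewrite (surjective_pairing (u T)), (surjective_pairing (fst (u T))).
  rewrite (surjective_pairing (v T)), (surjective_pairing (fst (v T))).
  f_equal; [f_equal|]; apply Heq; intros n; destruct (Hn n T HTT) as [? [? ?]]; trivial.
Qed.

Lemma solution_reverse {X Y Z : Banach} (A : X -> X) (B : Y -> Y) (C : Z -> Z)
    (F : X * Y * Z -> X) (G : X * Y * Z -> Y) (H : X * Y * Z -> Z) u0 (u : R -> X * Y * Z) :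
  solution_from A B C F G H u0 u ->
  solution_from (fun x => opp (A x)) (fun y => opp (B y)) (fun z => opp (C z))
    (fun w => opp (F w)) (fun w => opp (G w)) (fun w => opp (H w)) u0 (fun t => u (- t)).
Proof.
  rewrite !solution_lin_sol; intros [H0 [Hx [Hy Hz]]]; split; [now rewrite Ropp_0|].
  split; [|split]; [exact (lin_sol_reverse _ _ _ Hx)|exact (lin_sol_reverse _ _ _ Hy)
    |exact (lin_sol_reverse _ _ _ Hz)].
Qed.

Lemma lipschitz_opp {X Y Z V : Banach} (f : X * Y * Z -> V) (d : R) :
  lipschitz_on_E f d -> lipschitz_on_E (fun w => opp (f w)) d.
Proof.
  intros Hf u v.
  replace (minus (opp (f u)) (opp (f v))) with (opp (minus (f u) (f v))) by vec.
  rewrite norm_opp_eq; apply Hf.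
Qed.

Lemma solution_unique {X Y Z : Banach} (A : X -> X) (B : Y -> Y) (C : Z -> Z)
    (F : X * Y * Z -> X) (G : X * Y * Z -> Y) (H : X * Y * Z -> Z)
    (dx dy dz : R) u0 (u v : R -> X * Y * Z) :
  is_linear A -> is_linear B -> is_linear C ->
  (forall u, continuous F u) -> (forall u, continuous G u) -> (forall u, continuous H u) ->
  0 <= dx -> 0 <= dy -> 0 <= dz ->
  lipschitz_on_E F dx -> lipschitz_on_E G dy -> lipschitz_on_E H dz ->
  solution_from A B C F G H u0 u -> solution_from A B C F G H u0 v -> u = v.
Proof.
  intros HA HB HC HF HG HH Hdx Hdy Hdz FL GL HL Hu Hv.
  apply functional_extensionality; intros t; destruct (Rle_or_lt 0 t) as [Ht|Ht].
  - now apply (solution_unique_future A B C F G H dx dy dz u0 u v).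
  - rewrite <- (Ropp_involutive t).
    apply (solution_unique_future (fun x => opp (A x)) (fun y => opp (B y))
      (fun z => opp (C z)) (fun w => opp (F w)) (fun w => opp (G w)) (fun w => opp (H w))
      dx dy dz u0 (fun s => u (- s)) (fun s => v (- s)));
      try (now apply opp_is_linear); try (now apply lipschitz_opp);
      try (now apply solution_reverse); trivial; try lra.
    + intros w; now apply (continuous_opp (V := X)).
    + intros w; now apply (continuous_opp (V := Y)).
    + intros w; now apply (continuous_opp (V := Z)).
Qed.

(** * Limits of weighted paths *)

(** Telescoping: the tail of a geometric series is c r^n / (1 - r). *)
Lemma geometric_steps_limit {V : Banach} (a : nat -> V) (c r : R) :
  0 <= r < 1 -> (forall n, norm (minus (a (S n)) (a n)) <= c * r ^ n) ->
  exists l, forall n, norm (minus l (a n)) <= c / (1 - r) * r ^ n.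
Proof.
  intros Hr Hstep; apply geometric_cauchy_limit; trivial.
  assert (Hc : 0 <= c).
  { specialize (Hstep O); rewrite pow_O, Rmult_1_r in Hstep.
    exact (Rle_trans _ _ _ (norm_ge_0 _) Hstep). }
  assert (Hcr : 0 <= c / (1 - r)) by (apply Rdiv_le_0_compat; lra).
  assert (Hk : forall n k, norm (minus (a (n + k)%nat) (a n))
                           <= c / (1 - r) * (r ^ n - r ^ (n + k))).
  { intros n k; induction k as [|k IH].
    - rewrite Nat.add_0_r, Rminus_diag, Rmult_0_r.
      replace (minus (a n) (a n)) with (zero : V) by vec.
      right; exact (norm_zero (V := V)).
    - eapply Rle_trans; [apply (norm_minus_triangle _ (a (n + k)%nat))|].
      rewrite Nat.add_succ_r.
      replace (c / (1 - r) * (r ^ n - r ^ S (n + k)))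
        with (c * r ^ (n + k) + c / (1 - r) * (r ^ n - r ^ (n + k)))
        by (simpl; field; lra).
      apply Rplus_le_compat; [apply Hstep|exact IH]. }
  intros n m Hnm; replace m with (n + (m - n))%nat by lia.
  eapply Rle_trans; [apply Hk|]; apply Rmult_le_compat_l; trivial.
  pose proof (pow_le r (n + (m - n)) (proj1 Hr)); lra.
Qed.

Lemma weight_locally_bounded (sn sp t : R) :
  exists c, 0 < c /\ forall h, Rabs h < 1 -> weight sn sp (t + h) <= c.
Proof.
  exists (exp ((Rabs sn + Rabs sp) * (Rabs t + 1))); split; [apply exp_pos|].
  intros h Hh; apply exp_le_compat; eapply Rle_trans; [apply Rle_abs|].
  rewrite Rabs_mult; apply Rmult_le_compat; try apply Rabs_pos.
  - unfold sigma; pose proof (Rabs_pos sn); pose proof (Rabs_pos sp).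
    destruct (Rle_dec 0 (t + h)); lra.
  - pose proof (Rabs_triang t h); lra.
Qed.

(** The weight is bounded near t, so convergence in the weighted norm is
    locally uniform. *)
Lemma weighted_limit_continuous {V : Banach} (a : nat -> R -> V) (p : R -> V)
    (sn sp c r : R) :
  0 <= r < 1 -> (forall n t, continuous (a n) t) ->
  (forall n, weighted_le sn sp (fun t => minus (p t) (a n t)) (c * r ^ n)) ->
  forall t, continuous p t.
Proof.
  intros Hr Ha Hlim t; apply continuous_eps; intros eps Heps.
  destruct (weight_locally_bounded sn sp t) as [w [Hw Hwle]].
  assert (Hc : 0 <= c).
  { pose proof (weighted_le_nonneg _ _ _ _ (Hlim O)); simpl in *; lra. }
  destruct (geometric_small r (eps / (3 * (c + 1) * w)) Hr) as [n Hn].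
  { apply Rdiv_lt_0_compat; trivial; apply Rmult_lt_0_compat; lra. }
  specialize (Hn n (le_n n)).
  assert (Hnear : forall h, Rabs h < 1 ->
            norm (minus (p (t + h)) (a n (t + h))) < eps / 3).
  { intros h Hh; eapply Rle_lt_trans; [apply (Hlim n)|].
    assert (Hrn : 0 <= r ^ n) by (apply pow_le; lra).
    apply Rle_lt_trans with ((c + 1) * r ^ n * w).
    - apply Rmult_le_compat; [now apply Rmult_le_pos|apply Rlt_le, weight_pos| |auto].
      apply Rmult_le_compat_r; lra.
    - replace (eps / 3) with ((c + 1) * (eps / (3 * (c + 1) * w)) * w) by (field; lra).
      apply Rmult_lt_compat_r; trivial; apply Rmult_lt_compat_l; lra. }
  destruct (proj1 (continuous_eps _ _) (Ha n t) (eps / 3)) as [d [Hd Hcont]]; [lra|].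
  exists (Rmin 1 d); split; [apply Rmin_glb_lt; lra|].
  intros h Hh; apply Rmin_Rgt in Hh; destruct Hh as [Hh1 Hhd].
  pose proof (Hnear h Hh1) as N1; specialize (Hcont h Hhd).
  assert (N2 : norm (minus (p t) (a n t)) < eps / 3).
  { rewrite <- (Rplus_0_r t) at 1 2; apply Hnear; rewrite Rabs_R0; lra. }
  rewrite norm_minus_sym in N2.
  pose proof (norm_minus_triangle (p (t + h)) (a n (t + h)) (p t)).
  pose proof (norm_minus_triangle (a n (t + h)) (a n t) (p t)); lra.
Qed.

(** * The Lyapunov-Perron fixed point *)

(** In this section [theta] is a common bound for the four ratios of K times
    Lipschitz constant to the distance between growth rate and weight rate, and
    [c0] expresses that the constant forcing by the value of the nonlinearity at
    zero has weighted growth. *)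
Section LyapunovPerron.

Variables (X Y Z : Banach).
Variables (A : X -> X) (B : Y -> Y) (C : Z -> Z).
Variables (F : X * Y * Z -> X) (G : X * Y * Z -> Y) (H : X * Y * Z -> Z).
Hypotheses (A_lin : is_linear A) (B_lin : is_linear B) (C_lin : is_linear C).
Hypotheses (F_cont : forall u, continuous F u) (G_cont : forall u, continuous G u)
  (H_cont : forall u, continuous H u).
Variables (dx dy dz : R).
Hypotheses (dx_pos : 0 <= dx) (dy_pos : 0 <= dy) (dz_pos : 0 <= dz).
Hypotheses (F_lip : lipschitz_on_E F dx) (G_lip : lipschitz_on_E G dy)
  (H_lip : lipschitz_on_E H dz).
Variables (ax ay bY bz Kx Ky Kz sn sp : R).
Hypotheses (Kx_pos : 0 <= Kx) (Ky_pos : 0 <= Ky) (Kz_pos : 0 <= Kz).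
Hypotheses (A_bound : exp_bound A Kx ax) (B_bound : exp_bound B Ky ay)
  (B_bound_past : exp_bound (fun y => opp (B y)) Ky (- bY))
  (C_bound : exp_bound (fun z => opp (C z)) Kz (- bz)).
Hypotheses (ax_sn : ax < sn) (sn_bY : sn < bY) (ay_sp : ay < sp) (sp_bz : sp < bz)
  (sn_sp : sn <= sp).
Variable theta : R.
Hypotheses (theta_range : 0 <= theta < 1) (theta_x : Kx * dx <= theta * (sn - ax))
  (theta_y_future : Ky * dy <= theta * (sp - ay))
  (theta_y_past : Ky * dy <= theta * (bY - sn))
  (theta_z : Kz * dz <= theta * (bz - sp)).
Variable c0 : R.
Hypotheses (F_zero : weighted_le sn sp (fun _ => F zero) c0)
  (G_zero : weighted_le sn sp (fun _ => G zero) c0)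
  (H_zero : weighted_le sn sp (fun _ => H zero) c0).

(** Distance at most [N] in the weighted supremum norm, with the max norm of the
    product spelled out. *)
Definition close_paths (u v : R -> X * Y * Z) (N : R) : Prop :=
  weighted_le sn sp (fun t => minus (fst (fst (u t))) (fst (fst (v t)))) N /\
  weighted_le sn sp (fun t => minus (snd (fst (u t))) (snd (fst (v t)))) N /\
  weighted_le sn sp (fun t => minus (snd (u t)) (snd (v t))) N.

Definition bounded_path (u : R -> X * Y * Z) : Prop :=
  exists N, close_paths u (fun _ => zero) N.

(** [u] is a weighted solution of the three linear equations whose forcing is
    the nonlinearity along [v].  It plays the role of the Lyapunov-Perron
    operator v |-> u; its fixed points are the solutions in F_sigma. *)
Definition driven_by (y0 : Y) (v u : R -> X * Y * Z) : Prop :=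
  lin_sol A (fun t => F (v t)) (fun t => fst (fst (u t))) /\
  lin_sol B (fun t => G (v t)) (fun t => snd (fst (u t))) /\
  lin_sol C (fun t => H (v t)) (fun t => snd (u t)) /\
  snd (fst (u 0)) = y0 /\ bounded_path u.

Lemma weighted_le_triangle {V : Banach} (p q r : R -> V) (M N : R) :
  weighted_le sn sp (fun t => minus (p t) (q t)) M ->
  weighted_le sn sp (fun t => minus (q t) (r t)) N ->
  weighted_le sn sp (fun t => minus (p t) (r t)) (M + N).
Proof.
  intros HM HN t; rewrite Rmult_plus_distr_r.
  eapply Rle_trans; [apply (norm_minus_triangle _ (q t))|].
  apply Rplus_le_compat; [apply HM|apply HN].
Qed.

Lemma weighted_le_sym {V : Banach} (p q : R -> V) (M : R) :
  weighted_le sn sp (fun t => minus (p t) (q t)) M ->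
  weighted_le sn sp (fun t => minus (q t) (p t)) M.
Proof. intros HM t; rewrite norm_minus_sym; apply HM. Qed.

Lemma weighted_le_mono {V : Banach} (p : R -> V) (M N : R) :
  M <= N -> weighted_le sn sp p M -> weighted_le sn sp p N.
Proof.
  intros HMN HM t; eapply Rle_trans; [apply HM|].
  apply Rmult_le_compat_r; trivial; apply Rlt_le, weight_pos.
Qed.

Lemma close_paths_triangle (u v w : R -> X * Y * Z) (M N : R) :
  close_paths u v M -> close_paths v w N -> close_paths u w (M + N).
Proof.
  intros [Mx [My Mz]] [Nx [Ny Nz]]; split; [|split].
  - exact (weighted_le_triangle _ _ _ _ _ Mx Nx).
  - exact (weighted_le_triangle _ _ _ _ _ My Ny).
  - exact (weighted_le_triangle _ _ _ _ _ Mz Nz).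
Qed.

Lemma close_paths_sym (u v : R -> X * Y * Z) (M : R) :
  close_paths u v M -> close_paths v u M.
Proof.
  intros [Mx [My Mz]]; split; [|split];
    [exact (weighted_le_sym _ _ _ Mx)|exact (weighted_le_sym _ _ _ My)
    |exact (weighted_le_sym _ _ _ Mz)].
Qed.

Lemma bounded_paths_close (u v : R -> X * Y * Z) :
  bounded_path u -> bounded_path v -> exists N, close_paths u v N.
Proof.
  intros [M HM] [N HN]; exists (M + N).
  exact (close_paths_triangle _ _ _ _ _ HM (close_paths_sym _ _ _ HN)).
Qed.

Lemma lipschitz_weighted {V : Banach} (f : X * Y * Z -> V) (d M : R)
    (u v : R -> X * Y * Z) :
  lipschitz_on_E f d -> 0 <= d -> close_paths u v M ->
  weighted_le sn sp (fun t => minus (f (u t)) (f (v t))) (d * M).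
Proof.
  intros Hf Hd [Mx [My Mz]] t; rewrite Rmult_assoc; apply lipschitz_le; trivial.
Qed.

Lemma driven_continuous (y0 : Y) (v u : R -> X * Y * Z) :
  driven_by y0 v u -> forall t, continuous u t.
Proof.
  intros [Hx [Hy [Hz _]]] t.
  apply continuous_pair_path; [apply continuous_pair_path|].
  - exact (lin_sol_continuous _ _ _ Hx t).
  - exact (lin_sol_continuous _ _ _ Hy t).
  - exact (lin_sol_continuous _ _ _ Hz t).
Qed.

Lemma continuous_difference {V : Banach} (f : X * Y * Z -> V) (u v : R -> X * Y * Z) :
  (forall w, continuous f w) -> (forall t, continuous u t) ->
  (forall t, continuous v t) -> forall t, continuous (fun t => minus (f (u t)) (f (v t))) t.
Proof.
  intros Hf Hu Hv t; apply (continuous_minus (V := V)).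
  - now apply (continuous_comp u f).
  - now apply (continuous_comp v f).
Qed.

(** The difference of two driven paths solves the linear equations with forcing
    bounded by (Lipschitz constant) M, so each linear estimate yields the
    factor [theta]; only the Y-part remembers its initial value. *)
Lemma driven_contraction (y1 y2 : Y) (v1 v2 u1 u2 : R -> X * Y * Z) (M : R) :
  driven_by y1 v1 u1 -> driven_by y2 v2 u2 ->
  (forall t, continuous v1 t) -> (forall t, continuous v2 t) ->
  close_paths v1 v2 M -> close_paths u1 u2 (Ky * norm (minus y1 y2) + theta * M).
Proof.
  intros [Hx1 [Hy1 [Hz1 [E1 B1]]]] [Hx2 [Hy2 [Hz2 [E2 B2]]]] C1 C2 HM.
  destruct (bounded_paths_close _ _ B1 B2) as [L [Lx [_ Lz]]].
  assert (HM0 : 0 <= M) by exact (weighted_le_nonneg _ _ _ _ (proj1 HM)).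
  assert (HthM : 0 <= theta * M) by (apply Rmult_le_pos; lra).
  assert (Hy0 : 0 <= Ky * norm (minus y1 y2))
    by (apply Rmult_le_pos; trivial; apply norm_ge_0).
  assert (Hth : forall K d r, K * d <= theta * r -> K * (d * M) <= theta * M * r).
  { intros K d r Hle; apply (Rmult_le_compat_r M) in Hle; trivial; lra. }
  split; [|split].
  - apply (weighted_le_mono _ (theta * M)); [lra|].
    apply (stable_estimate A _ _ Kx ax sn sp (dx * M) (theta * M) L)
      with (8 := lin_sol_minus _ _ _ _ _ A_lin Hx1 Hx2);
      auto using continuous_difference, lipschitz_weighted.
  - pose proof (center_estimate B _ _ Ky ay bY sn sp (dy * M) (theta * M) B_lin B_bound
      B_bound_past Ky_pos HthM ay_sp sn_bY (Hth _ _ _ theta_y_future)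
      (Hth _ _ _ theta_y_past) (lin_sol_minus _ _ _ _ _ B_lin Hy1 Hy2)) as Hc.
    cbv beta in Hc; rewrite E1, E2 in Hc; apply Hc.
    + now apply continuous_difference.
    + now apply lipschitz_weighted.
  - apply (weighted_le_mono _ (theta * M)); [lra|].
    apply (unstable_estimate C _ _ Kz bz sn sp (dz * M) (theta * M) L)
      with (8 := lin_sol_minus _ _ _ _ _ C_lin Hz1 Hz2);
      auto using continuous_difference, lipschitz_weighted.
Qed.

Lemma driving_bounded {V : Banach} (f : X * Y * Z -> V) (d : R) (v : R -> X * Y * Z)
    (N : R) :
  lipschitz_on_E f d -> 0 <= d -> weighted_le sn sp (fun _ => f zero) c0 ->
  close_paths v (fun _ => zero) N ->
  weighted_le sn sp (fun t => f (v t)) (d * N + c0).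
Proof.
  intros Hf Hd Hf0 HN t; rewrite Rmult_plus_distr_r.
  replace (f (v t)) with (plus (minus (f (v t)) (f zero)) (f zero)) by vec.
  eapply Rle_trans; [apply norm_plus_le|]; apply Rplus_le_compat; [|apply Hf0].
  exact (lipschitz_weighted f d N v (fun _ => zero) Hf Hd HN t).
Qed.

(** Existence asks only for some finite bound on each component; once the path
    is known to be of weighted growth, [driven_contraction] supplies the factor
    [theta]. *)
Lemma driven_exists (y0 : Y) (v : R -> X * Y * Z) :
  (forall t, continuous v t) -> bounded_path v -> exists u, driven_by y0 v u.
Proof.
  intros Cv [N HN].
  assert (HN0 : 0 <= N) by exact (weighted_le_nonneg _ _ _ _ (proj1 HN)).
  assert (Hc0 : 0 <= c0) by exact (weighted_le_nonneg _ _ _ _ F_zero).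
  pose proof (driving_bounded F dx v N F_lip dx_pos F_zero HN) as BF.
  pose proof (driving_bounded G dy v N G_lip dy_pos G_zero HN) as BG.
  pose proof (driving_bounded H dz v N H_lip dz_pos H_zero HN) as BH.
  assert (CF : forall t, continuous (fun s => F (v s)) t)
    by (intros t; now apply (continuous_comp v F)).
  assert (CG : forall t, continuous (fun s => G (v s)) t)
    by (intros t; now apply (continuous_comp v G)).
  assert (CH : forall t, continuous (fun s => H (v s)) t)
    by (intros t; now apply (continuous_comp v H)).
  assert (Hbound : forall K M r, 0 <= K -> 0 <= M -> 0 < r ->
    exists N, 0 <= N /\ K * M <= N * r).
  { intros K M r HK HM Hr; exists (K * M / r); split.
    - apply Rdiv_le_0_compat; trivial; now apply Rmult_le_pos.
    - right; field; lra. }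
  assert (Hforce : forall d, 0 <= d -> 0 <= d * N + c0)
    by (intros d Hd; pose proof (Rmult_le_pos d N Hd HN0); lra).
  destruct (Hbound Kx _ (sn - ax) Kx_pos (Hforce dx dx_pos)) as [Nx [Nx0 HNx]]; [lra|].
  destruct (Hbound Kz _ (bz - sp) Kz_pos (Hforce dz dz_pos)) as [Nz [Nz0 HNz]]; [lra|].
  destruct (Hbound Ky _ (Rmin (sp - ay) (bY - sn)) Ky_pos (Hforce dy dy_pos))
    as [Ny [Ny0 HNy]]; [apply Rmin_glb_lt; lra|].
  destruct (stable_solution_exists A _ Kx ax sn sp _ Nx A_lin A_bound Kx_pos Nx0
    ax_sn sn_sp HNx CF BF) as [x [Hx Bx]].
  destruct (lin_sol_exists B _ y0 B_lin CG) as [y [Hy Ey]].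
  destruct (unstable_solution_exists C _ Kz bz sn sp _ Nz C_lin C_bound Kz_pos Nz0
    sp_bz sn_sp HNz CH BH) as [z [Hz Bz]].
  assert (By : weighted_le sn sp y (Ky * norm (y 0) + Ny)).
  { apply (center_estimate B _ _ Ky ay bY sn sp (dy * N + c0) Ny) with (10 := Hy);
      trivial; eapply Rle_trans; try exact HNy; apply Rmult_le_compat_l; trivial;
      [apply Rmin_l|apply Rmin_r]. }
  exists (fun t => (x t, y t, z t)).
  split; [exact Hx|split; [exact Hy|split; [exact Hz|split; [exact Ey|]]]].
  assert (Hy0 : 0 <= Ky * norm (y 0)) by (apply Rmult_le_pos; trivial; apply norm_ge_0).
  exists (Nx + (Ky * norm (y 0) + Ny) + Nz).
  assert (Hzero : forall (V : Banach) (p : R -> V) M M', M <= M' -> weighted_le sn sp p M ->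
            weighted_le sn sp (fun t => minus (p t) zero) M').
  { intros V p M M' HMM Hp t; replace (minus (p t) zero) with (p t) by vec.
    exact (weighted_le_mono p M M' HMM Hp t). }
  split; [|split].
  - apply (Hzero X x Nx); trivial; lra.
  - apply (Hzero Y y (Ky * norm (y 0) + Ny)); trivial; lra.
  - apply (Hzero Z z Nz); trivial; lra.
Qed.

Lemma close_paths_eq (u v : R -> X * Y * Z) (c : R) :
  (forall n, close_paths u v (c * theta ^ n)) -> u = v.
Proof.
  intros Hc; apply functional_extensionality; intros t.
  assert (Heq : forall (V : Banach) (p q : R -> V),
    (forall n, weighted_le sn sp (fun t => minus (p t) (q t)) (c * theta ^ n)) ->
    p t = q t).
  { intros V p q Hpq; apply (plus_reg_r (opp (q t))); rewrite plus_opp_r.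
    apply (norm_eq_zero (V := V)), Rle_antisym; [|apply norm_ge_0].
    apply (le_geometric_limit _ _ (c * weight sn sp t) theta theta_range).
    intros n; rewrite Rplus_0_l; eapply Rle_trans; [apply (Hpq n)|right; ring]. }
  rewrite (surjective_pairing (u t)), (surjective_pairing (fst (u t))).
  rewrite (surjective_pairing (v t)), (surjective_pairing (fst (v t))).
  f_equal; [f_equal|].
  - apply (Heq X (fun t => fst (fst (u t))) (fun t => fst (fst (v t)))).
    intros n; exact (proj1 (Hc n)).
  - apply (Heq Y (fun t => snd (fst (u t))) (fun t => snd (fst (v t)))).
    intros n; exact (proj1 (proj2 (Hc n))).
  - apply (Heq Z (fun t => snd (u t)) (fun t => snd (v t))).
    intros n; exact (proj2 (proj2 (Hc n))).
Qed.

(** With a = K_y times the distance of y1 and y2, the contraction turns the bound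
    M into a + theta M.  The fixed point of this affine map is a / (1 - theta),
    and the excess over it shrinks by [theta] at each step. *)
Lemma fixed_paths_close (y1 y2 : Y) (u1 u2 : R -> X * Y * Z) :
  driven_by y1 u1 u1 -> driven_by y2 u2 u2 ->
  exists c, forall n,
    close_paths u1 u2 (Ky * norm (minus y1 y2) / (1 - theta) + c * theta ^ n).
Proof.
  intros D1 D2.
  destruct (bounded_paths_close _ _ (proj2 (proj2 (proj2 (proj2 D1))))
    (proj2 (proj2 (proj2 (proj2 D2))))) as [M HM].
  set (a := Ky * norm (minus y1 y2)).
  exists (M - a / (1 - theta)); induction n as [|n IH].
  - rewrite pow_O, Rmult_1_r.
    now replace (a / (1 - theta) + (M - a / (1 - theta))) with M by ring.
  - pose proof (driven_contraction _ _ _ _ _ _ _ D1 D2 (driven_continuous _ _ _ D1)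
      (driven_continuous _ _ _ D2) IH) as Hc.
    fold a in Hc.
    replace (a / (1 - theta) + (M - a / (1 - theta)) * theta ^ S n)
      with (a + theta * (a / (1 - theta) + (M - a / (1 - theta)) * theta ^ n));
      trivial; simpl; field; lra.
Qed.

Lemma fixed_path_unique (y0 : Y) (u v : R -> X * Y * Z) :
  driven_by y0 u u -> driven_by y0 v v -> u = v.
Proof.
  intros Du Dv; destruct (fixed_paths_close _ _ _ _ Du Dv) as [c Hc].
  apply (close_paths_eq u v c); intros n; specialize (Hc n).
  replace (minus y0 y0) with (zero : Y) in Hc by vec.
  rewrite (norm_zero : norm (zero : Y) = 0) in Hc.
  replace (Ky * 0 / (1 - theta) + c * theta ^ n) with (c * theta ^ n) in Hc
    by (field; lra); exact Hc.
Qed.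

Lemma fixed_path_initial_lipschitz (y1 y2 : Y) (u1 u2 : R -> X * Y * Z) :
  driven_by y1 u1 u1 -> driven_by y2 u2 u2 ->
  norm (minus (fst (fst (u1 0))) (fst (fst (u2 0)))) <= Ky / (1 - theta) * norm (minus y1 y2)
  /\ norm (minus (snd (u1 0)) (snd (u2 0))) <= Ky / (1 - theta) * norm (minus y1 y2).
Proof.
  intros D1 D2; destruct (fixed_paths_close _ _ _ _ D1 D2) as [c Hc].
  replace (Ky / (1 - theta) * norm (minus y1 y2))
    with (Ky * norm (minus y1 y2) / (1 - theta)) by (field; lra).
  split; apply (le_geometric_limit _ _ c theta theta_range); intros n;
    destruct (Hc n) as [Hx [_ Hz]].
  - specialize (Hx 0); rewrite weight_0, Rmult_1_r in Hx; exact Hx.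
  - specialize (Hz 0); rewrite weight_0, Rmult_1_r in Hz; exact Hz.
Qed.

Lemma path_limit (u : nat -> R -> X * Y * Z) (c : R) :
  (forall n t, continuous (u n) t) ->
  (forall n, close_paths (u (S n)) (u n) (c * theta ^ n)) ->
  exists p, (forall t, continuous p t) /\
    forall n, close_paths p (u n) (c / (1 - theta) * theta ^ n).
Proof.
  intros Cu Hstep.
  assert (Hcomp : forall (V : Banach) (a : nat -> R -> V),
    (forall n t, continuous (a n) t) ->
    (forall n, weighted_le sn sp (fun t => minus (a (S n) t) (a n t)) (c * theta ^ n)) ->
    exists p : R -> V, (forall t, continuous p t) /\
      forall n, weighted_le sn sp (fun t => minus (p t) (a n t)) (c / (1 - theta) * theta ^ n)).
  { intros V a Ca Ha.
    assert (Hex : forall t, exists l, forall n,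
      norm (minus l (a n t)) <= c * weight sn sp t / (1 - theta) * theta ^ n).
    { intros t; apply (geometric_steps_limit (fun n => a n t)); trivial.
      intros n; eapply Rle_trans; [apply (Ha n)|right; ring]. }
    exists (fun t => proj1_sig (constructive_indefinite_description _ (Hex t))).
    assert (Hp : forall n, weighted_le sn sp
      (fun t => minus (proj1_sig (constructive_indefinite_description _ (Hex t))) (a n t))
      (c / (1 - theta) * theta ^ n)).
    { intros n t; destruct (constructive_indefinite_description _ (Hex t)) as [l Hl].
      eapply Rle_trans; [apply (Hl n)|right; field; lra]. }
    split; trivial; exact (weighted_limit_continuous a _ sn sp _ theta theta_range Ca Hp). }
  destruct (Hcomp X (fun n t => fst (fst (u n t)))) as [x [Cx Hx]].
  { intros n t; apply (continuous_fst_path (fun s => fst (u n s))).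
    now apply continuous_fst_path. }
  { intros n; exact (proj1 (Hstep n)). }
  destruct (Hcomp Y (fun n t => snd (fst (u n t)))) as [y [Cy Hy]].
  { intros n t; apply (continuous_snd_path (fun s => fst (u n s))).
    now apply continuous_fst_path. }
  { intros n; exact (proj1 (proj2 (Hstep n))). }
  destruct (Hcomp Z (fun n t => snd (u n t))) as [z [Cz Hz]].
  { intros n t; now apply continuous_snd_path. }
  { intros n; exact (proj2 (proj2 (Hstep n))). }
  exists (fun t => (x t, y t, z t)); split.
  - intros t; apply continuous_pair_path; [apply continuous_pair_path|]; trivial.
  - intros n; split; [exact (Hx n)|split; [exact (Hy n)|exact (Hz n)]].
Qed.

(** Picard iteration from the zero path, with the next path chosen by the
    epsilon operator.  The limit p drives a path q; by the contraction q is
    also the limit of the iterates, so p = q. *)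
Lemma fixed_path_exists (y0 : Y) : exists u, driven_by y0 u u.
Proof.
  set (next := fun v => epsilon (inhabits (fun _ : R => zero : X * Y * Z)) (driven_by y0 v)).
  set (u := fun n => Nat.iter n next (fun _ => zero)).
  assert (Hu : forall n, (forall t, continuous (u n) t) /\ bounded_path (u n) /\
                         driven_by y0 (u n) (u (S n))).
  { assert (Hnext : forall v, (forall t, continuous v t) -> bounded_path v ->
                              driven_by y0 v (next v)).
    { intros v Cv Bv; apply epsilon_spec; now apply driven_exists. }
    induction n as [|n [_ [_ IH]]].
    - assert (Hc : forall t, continuous (u O) t) by (intros t; apply continuous_const).
      assert (Hb : bounded_path (u O)).
      { assert (Hz : forall V : Banach, norm (minus zero zero : V) <= 0).
        { intros V; right; transitivity (norm (zero : V)); [f_equal; vec|].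
          exact (norm_zero (V := V)). }
        exists 0; split; [|split]; intros t; rewrite Rmult_0_l;
          [exact (Hz X)|exact (Hz Y)|exact (Hz Z)]. }
      split; [|split]; trivial; now apply Hnext.
    - pose proof (driven_continuous _ _ _ IH) as Hc.
      assert (Hb : bounded_path (u (S n))) by apply IH.
      split; [|split]; trivial; now apply Hnext. }
  destruct (bounded_paths_close (u 1%nat) (u O)) as [c Hc]; try apply Hu.
  assert (Hcontr : forall y M v w v' w', driven_by y v v' -> driven_by y w w' ->
    (forall t, continuous v t) -> (forall t, continuous w t) -> close_paths v w M ->
    close_paths v' w' (theta * M)).
  { intros y M v w v' w' Dv Dw Cv Cw HM.
    pose proof (driven_contraction _ _ _ _ _ _ _ Dv Dw Cv Cw HM) as Hd.
    replace (minus y y) with (zero : Y) in Hd by vec.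
    rewrite (norm_zero : norm (zero : Y) = 0), Rmult_0_r, Rplus_0_l in Hd; exact Hd. }
  assert (Hstep : forall n, close_paths (u (S n)) (u n) (c * theta ^ n)).
  { induction n as [|n IH]; [now rewrite pow_O, Rmult_1_r|].
    replace (c * theta ^ S n) with (theta * (c * theta ^ n)) by (simpl; ring).
    apply (Hcontr y0 _ (u (S n)) (u n)); trivial; apply Hu. }
  destruct (path_limit u c (fun n => proj1 (Hu n)) Hstep) as [p [Cp Hp]].
  assert (Bp : bounded_path p).
  { destruct (proj1 (proj2 (Hu O))) as [N HN].
    exists (c / (1 - theta) * theta ^ 0 + N).
    exact (close_paths_triangle _ _ _ _ _ (Hp O) HN). }
  destruct (driven_exists y0 p Cp Bp) as [q Dq].
  assert (Hpq : p = q).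
  { apply (close_paths_eq p q (2 * theta * (c / (1 - theta)))); intros n.
    replace (2 * theta * (c / (1 - theta)) * theta ^ n)
      with (c / (1 - theta) * theta ^ S n + theta * (c / (1 - theta) * theta ^ n))
      by (simpl; ring).
    apply (close_paths_triangle p (u (S n)) q); [apply Hp|].
    apply close_paths_sym.
    apply (Hcontr y0 _ p (u n)); trivial; apply Hu. }
  exists p; rewrite <- Hpq in Dq; exact Dq.
Qed.

End LyapunovPerron.

(** * The center manifold *)

(** The extended-real supremum is finite exactly when some real number bounds
    all its values; it cannot be minus infinity, since t = 0 contributes a real
    value. *)
Lemma F_sigma_iff {X Y Z : Banach} (sn sp : R) (u : R -> X * Y * Z) :
  F_sigma sn sp u <-> (forall t, continuous u t) /\ bounded_path X Y Z sn sp u.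
Proof.
  assert (Hsigma : forall t, weight sn sp t * exp (- (sigma sn sp t * t)) = 1).
  { intros t; unfold weight; rewrite <- exp_plus, Rplus_opp_r; apply exp_0. }
  assert (Hmax : forall (w : X * Y * Z), maxnorm w =
    Rmax (norm (fst (fst w))) (Rmax (norm (snd (fst w))) (norm (snd w))))
    by (now intros [[x y] z]).
  destruct (Lub_Rbar_correct
    (fun r => exists t : R, r = exp (- (sigma sn sp t * t)) * maxnorm (u t)))
    as [Hub Hlub].
  fold (sigma_norm sn sp u) in Hub, Hlub.
  split; intros [Cu Hu]; split; trivial.
  - assert (HN : exists N, forall t, maxnorm (u t) <= N * weight sn sp t).
    { destruct (sigma_norm sn sp u) as [N| |]; [|easy|].
      - exists N; intros t.
        specialize (Hub _ (ex_intro _ t eq_refl)); simpl in Hub.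
        apply (Rmult_le_compat_r (weight sn sp t)) in Hub;
          [|apply Rlt_le, weight_pos].
        rewrite Rmult_comm, <- Rmult_assoc, Hsigma, Rmult_1_l in Hub; exact Hub.
      - destruct (Hub _ (ex_intro _ 0 eq_refl)). }
    destruct HN as [N HN]; exists N.
    assert (Hzero : forall (V : Banach) (v : V) r, norm v <= r -> norm (minus v zero) <= r).
    { intros V v r Hv; replace (minus v zero) with v by vec; exact Hv. }
    split; [|split]; intros t; apply Hzero; refine (Rle_trans _ _ _ _ (HN t));
      rewrite Hmax.
    + apply Rmax_l.
    + eapply Rle_trans; [apply Rmax_l|apply Rmax_r].
    + eapply Rle_trans; [apply Rmax_r|apply Rmax_r].
  - destruct Hu as [N [Hx [Hy Hz]]].
    apply (Rbar_le_lt_trans _ (Finite N)); [|easy].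
    apply Hlub; intros r [t ->]; simpl.
    assert (Hzero : forall (V : Banach) (v : V) r, norm (minus v zero) <= r -> norm v <= r).
    { intros V v r Hv; replace v with (minus v zero) by vec; exact Hv. }
    assert (Hle : maxnorm (u t) <= N * weight sn sp t).
    { rewrite Hmax; repeat apply Rmax_lub; apply Hzero;
        [exact (Hx t)|exact (Hy t)|exact (Hz t)]. }
    apply (Rmult_le_compat_l (exp (- (sigma sn sp t * t)))) in Hle;
      [|apply Rlt_le, exp_pos].
    replace (exp (- (sigma sn sp t * t)) * (N * weight sn sp t))
      with (N * (weight sn sp t * exp (- (sigma sn sp t * t)))) in Hle by ring.
    rewrite Hsigma, Rmult_1_r in Hle; exact Hle.
Qed.

Lemma exp_bound_of_opnorm {V : Banach} (A : V -> V) (K a : R) :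
  is_linear A ->
  (forall t, 0 <= t -> Rbar_le (opnorm (expop t A)) (K * exp (a * t))) ->
  0 <= K /\ exp_bound A K a.
Proof.
  intros HA Hop; split.
  - destruct (opnorm_bound _ _ (expop_is_linear A 0 HA) (Hop 0 (Rle_refl 0))) as [HK _].
    rewrite Rmult_0_r, exp_0, Rmult_1_r in HK; exact HK.
  - intros t v Ht.
    exact (proj2 (opnorm_bound _ _ (expop_is_linear A t HA) (Hop t Ht)) v).
Qed.

Lemma exp_bound_opp_of_opnorm {V : Banach} (A : V -> V) (K a : R) :
  is_linear A ->
  (forall t, 0 <= t -> Rbar_le (opnorm (expop (- t) A)) (K * exp (a * t))) ->
  0 <= K /\ exp_bound (fun v => opp (A v)) K a.
Proof.
  intros HA Hop; apply exp_bound_of_opnorm; [now apply opp_is_linear|].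
  intros t Ht.
  replace (expop t (fun v => opp (A v))) with (expop (- t) A); [now apply Hop|].
  apply functional_extensionality; intros v; symmetry; now apply expop_opp.
Qed.

(** Turns the strict inequalities of the choice-of-sigma condition into one
    contraction factor. *)
Lemma common_ratio (l : list (R * R)) :
  (forall p, In p l -> 0 <= fst p < snd p) ->
  exists theta, 0 <= theta < 1 /\ forall p, In p l -> fst p <= theta * snd p.
Proof.
  induction l as [|[k r] l IH]; intros Hl.
  - exists 0; split; [lra|easy].
  - destruct IH as [theta [Hth Hle]]; [intros p Hp; apply Hl; now right|].
    specialize (Hl (k, r) (or_introl eq_refl)) as Hkr; simpl in Hkr.
    assert (Hq : 0 <= k / r < 1).
    { split; [apply Rdiv_le_0_compat; lra|].
      apply (Rmult_lt_reg_r r); [lra|]; replace (k / r * r) with k by (field; lra); lra. }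
    exists (Rmax theta (k / r)); split.
    + split; [eapply Rle_trans; [apply Hth|apply Rmax_l]|apply Rmax_lub_lt; lra].
    + intros p [<-|Hp]; simpl.
      * apply Rle_trans with (k / r * r); [right; field; lra|].
        apply Rmult_le_compat_r; [lra|apply Rmax_r].
      * eapply Rle_trans; [now apply Hle|].
        apply Rmult_le_compat_r; [|apply Rmax_l].
        specialize (Hl p (or_intror Hp)); lra.
Qed.

Theorem theorem3p9 (X Y Z : Banach)
  (A : X -> X) (B : Y -> Y) (C : Z -> Z)
  (A_bounded : is_linear A) (B_bounded : is_linear B) (C_bounded : is_linear C)
  (F : X * Y * Z -> X) (G : X * Y * Z -> Y) (H : X * Y * Z -> Z)
  (F_cont : forall u, continuous F u)
  (G_cont : forall u, continuous G u)
  (H_cont : forall u, continuous H u)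
  (alpha_x alpha_y beta_y beta_z K_x K_y K_z : R)
  (trichotomy : exp_trichotomy A B C alpha_x alpha_y beta_y beta_z K_x K_y K_z)
  (delta_x delta_y delta_z : R)
  (delta_x_pos : 0 < delta_x) (delta_y_pos : 0 < delta_y) (delta_z_pos : 0 < delta_z)
  (F_lip : lipschitz_on_E F delta_x)
  (G_lip : lipschitz_on_E G delta_y)
  (H_lip : lipschitz_on_E H delta_z)
  (gap_xy : beta_y - alpha_x > K_x * delta_x + K_y * delta_y)
  (gap_yz : beta_z - alpha_y > K_y * delta_y + K_z * delta_z)
  (sigma_n sigma_p : R)
  (constants : alpha_x < sigma_n /\ sigma_n < alpha_y /\ alpha_y <= beta_y /\
               beta_y < sigma_p /\ sigma_p < beta_z)
  (choice_sigma_n : alpha_x + K_x * delta_x < sigma_n /\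
                    sigma_n < beta_y - K_y * delta_y)
  (choice_sigma_p : alpha_y + K_y * delta_y < sigma_p /\
                    sigma_p < beta_z - K_z * delta_z)
  (* Not in the source, but the claim is false without it: it says that the
     constant path (F 0, G 0, H 0) belongs to F_sigma. *)
  (zero_or_sign : (F zero = zero /\ G zero = zero /\ H zero = zero) \/
                  (sigma_n <= 0 /\ 0 <= sigma_p)) :
  exists! Phi : Y -> X * Z,
    lipschitz_map Phi /\
    forall u : X * Y * Z,
      graph Phi u <-> center_manifold A B C F G H sigma_n sigma_p u.
Proof.
  destruct trichotomy as [_ [_ [_ Hexp]]].
  destruct constants as [ax_sn [sn_ay [ay_bY [bY_sp sp_bz]]]].
  destruct choice_sigma_n as [Hn1 Hn2]; destruct choice_sigma_p as [Hp1 Hp2].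
  destruct (exp_bound_of_opnorm A K_x alpha_x A_bounded) as [Kx_pos A_exp];
    [intros t Ht; now apply Hexp|].
  destruct (exp_bound_of_opnorm B K_y alpha_y B_bounded) as [Ky_pos B_exp];
    [intros t Ht; now apply Hexp|].
  destruct (exp_bound_opp_of_opnorm B K_y (- beta_y) B_bounded) as [_ B_exp_past];
    [intros t Ht; now apply Hexp|].
  destruct (exp_bound_opp_of_opnorm C K_z (- beta_z) C_bounded) as [Kz_pos C_exp];
    [intros t Ht; now apply Hexp|].
  pose proof (Rmult_le_pos _ _ Kx_pos (Rlt_le _ _ delta_x_pos)) as Kdx.
  pose proof (Rmult_le_pos _ _ Ky_pos (Rlt_le _ _ delta_y_pos)) as Kdy.
  pose proof (Rmult_le_pos _ _ Kz_pos (Rlt_le _ _ delta_z_pos)) as Kdz.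
  destruct (common_ratio ((K_x * delta_x, sigma_n - alpha_x) ::
    (K_y * delta_y, sigma_p - alpha_y) :: (K_y * delta_y, beta_y - sigma_n) ::
    (K_z * delta_z, beta_z - sigma_p) :: nil)) as [theta [theta_range Htheta]].
  { intros p [<-|[<-|[<-|[<-|[]]]]]; simpl; lra. }
  pose proof (Htheta _ (or_introl eq_refl)) as theta_x.
  pose proof (Htheta _ (or_intror (or_introl eq_refl))) as theta_y_future.
  pose proof (Htheta _ (or_intror (or_intror (or_introl eq_refl)))) as theta_y_past.
  pose proof (Htheta _ (or_intror (or_intror (or_intror (or_introl eq_refl))))) as theta_z.
  simpl in theta_x, theta_y_future, theta_y_past, theta_z; clear Htheta.
  (* If the sign condition holds, the weight is at least 1 everywhere, so
     constant paths are bounded by it. *)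
  assert (Hc0 : exists c0, weighted_le sigma_n sigma_p (fun _ => F zero) c0 /\
    weighted_le sigma_n sigma_p (fun _ => G zero) c0 /\
    weighted_le sigma_n sigma_p (fun _ => H zero) c0).
  { destruct zero_or_sign as [[F0 [G0 H0]]|[Hsn Hsp]].
    - exists 0; rewrite F0, G0, H0.
      split; [|split]; intros t; rewrite Rmult_0_l; right; exact norm_zero.
    - assert (Hw : forall t, 1 <= weight sigma_n sigma_p t).
      { intros t; unfold weight, sigma; rewrite <- exp_0; apply exp_le_compat.
        destruct (Rle_dec 0 t); nra. }
      pose proof (norm_ge_0 (F zero)); pose proof (norm_ge_0 (G zero));
        pose proof (norm_ge_0 (H zero)).
      exists (norm (F zero) + norm (G zero) + norm (H zero)).
      split; [|split]; intros t; specialize (Hw t); nra. }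
  destruct Hc0 as [c0 [F0 [G0 H0]]].
  assert (Hfix : forall y0, exists u,
    driven_by X Y Z A B C F G H sigma_n sigma_p y0 u u).
  { intros y0.
    apply (fixed_path_exists X Y Z A B C F G H) with (theta := theta) (c0 := c0)
      (dx := delta_x) (dy := delta_y) (dz := delta_z) (ax := alpha_x) (ay := alpha_y)
      (bY := beta_y) (bz := beta_z) (Kx := K_x) (Ky := K_y) (Kz := K_z); trivial; lra. }
  assert (Hsol : forall u0 u, solution_from A B C F G H u0 u ->
    F_sigma sigma_n sigma_p u ->
    driven_by X Y Z A B C F G H sigma_n sigma_p (snd (fst u0)) u u).
  { intros u0 u Hu HF; apply F_sigma_iff in HF; destruct HF as [_ Bu].
    apply solution_lin_sol in Hu; destruct Hu as [<- [Hx [Hy Hz]]].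
    split; [exact Hx|split; [exact Hy|split; [exact Hz|now split]]]. }
  assert (Hcenter : forall y0 u, driven_by X Y Z A B C F G H sigma_n sigma_p y0 u u ->
    center_manifold A B C F G H sigma_n sigma_p (u 0)).
  { intros y0 u Du; exists u.
    assert (Hu : solution_from A B C F G H (u 0) u).
    { apply solution_lin_sol; split; trivial; destruct Du as [Hx [Hy [Hz _]]].
      split; [exact Hx|split; [exact Hy|exact Hz]]. }
    split; [split; trivial|].
    - intros v Hv; apply (solution_unique A B C F G H delta_x delta_y delta_z (u 0));
        trivial; lra.
    - apply F_sigma_iff; split; [exact (solution_continuous _ _ _ _ _ _ _ _ Hu)|].
      apply Du. }
  set (path := fun y0 => proj1_sig (constructive_indefinite_description _ (Hfix y0))).
  assert (Hpath : forall y0,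
    driven_by X Y Z A B C F G H sigma_n sigma_p y0 (path y0) (path y0)).
  { intros y0; exact (proj2_sig (constructive_indefinite_description _ (Hfix y0))). }
  assert (Hgraph : forall u, graph (fun y0 => (fst (fst (path y0 0)), snd (path y0 0))) u <->
    center_manifold A B C F G H sigma_n sigma_p u).
  { intros u0; split.
    - intros [y0 ->]; simpl.
      replace (fst (fst (path y0 0)), y0, snd (path y0 0)) with (path y0 0);
        [exact (Hcenter y0 _ (Hpath y0))|].
      destruct (Hpath y0) as [_ [_ [_ [E _]]]]; revert E.
      destruct (path y0 0) as [[x y] z]; simpl; now intros ->.
    - intros [u [[Hu _] HF]]; exists (snd (fst u0)); simpl.
      rewrite (fixed_path_unique X Y Z A B C F G H) with (u := path (snd (fst u0)))
        (v := u) (y0 := snd (fst u0)) (theta := theta)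
        (dx := delta_x) (dy := delta_y) (dz := delta_z) (ax := alpha_x) (ay := alpha_y)
        (bY := beta_y) (bz := beta_z) (Kx := K_x) (Ky := K_y) (Kz := K_z)
        (sn := sigma_n) (sp := sigma_p); trivial; try lra; [|now apply Hsol].
      rewrite (proj1 Hu); now destruct u0 as [[x y] z]. }
  exists (fun y0 => (fst (fst (path y0 0)), snd (path y0 0))); split.
  - split; trivial.
    exists (K_y / (1 - theta)).
    split; [apply Rdiv_le_0_compat; lra|]; intros y1 y2.
    destruct (fixed_path_initial_lipschitz X Y Z A B C F G H) with (u1 := path y1)
        (u2 := path y2) (y1 := y1) (y2 := y2) (theta := theta)
        (dx := delta_x) (dy := delta_y) (dz := delta_z) (ax := alpha_x) (ay := alpha_y)
        (bY := beta_y) (bz := beta_z) (Kx := K_x) (Ky := K_y) (Kz := K_z)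
        (sn := sigma_n) (sp := sigma_p) as [Lx Lz]; trivial; try lra.
    repeat apply Rmax_lub; [exact Lx| |exact Lz].
    apply Rle_trans with 0; [right; exact norm_zero|].
    apply Rmult_le_pos; [apply Rdiv_le_0_compat; lra|apply norm_ge_0].
  - intros Phi [_ HPhi]; apply functional_extensionality; intros y0.
    assert (Hin : graph Phi (fst (fst (path y0 0)), y0, snd (path y0 0))).
    { apply HPhi, Hgraph; now exists y0. }
    destruct Hin as [y1 E]; injection E as E1 E2 E3; subst y1.
    rewrite E1, E3; now destruct (Phi y0).
Qed.
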